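(* The homogeneous space $\mathsf{SL}(4,\mathbb{R})/\mathsf{SL}(2,\mathbb{R})$ (with $\mathsf{SL}(2,\mathbb{R})$ embedded as the lower right $2\times2$ block) carries an $\mathsf{SL}(4,\mathbb{R})$-invariant $\mathsf{SO}^*(6)$-structure. In particular, after the identification $\mathfrak{m}\cong[\mathsf{EH}]$ given by $\alpha_{[\mathsf{EH}]}$ (see context), one has $H_o=H_0$ and $\omega_o=\omega_0$ for the standard hypercomplex structure $H_0$ and the standard symplectic form $\omega_0$ on $[\mathsf{EH}]$; that is, $H_0$ and $\omega_0$ transported to $\mathfrak{m}\cong T_o(\mathsf{SL}(4,\mathbb{R})/\mathsf{SL}(2,\mathbb{R}))$ are the values at the origin $o$ of the invariant structure.
   Context: An $\mathsf{SO}^*(2n)$-structure on a $4n$-manifold is an almost hypercomplex skew-Hermitian structure $(H,\omega)$: a triple $H=\{J_1,J_2,J_3\}$ of almost complex structures with $J_1J_2=-J_2J_1=J_3$ and a non-degenerate 2-form $\omega$ with $\omega(J_aX,J_aY)=\omega(X,Y)$. Here $n=3$. $[\mathsf{EH}]\cong\mathbb{R}^{12}$ has a basis $\mathcal{B}=(e_1,\dots,e_6,f_1,\dots,f_6)$ (skew-Hermitian basis) in which the standard structure is given by: $J_1e_c=e_{c+3}$, $J_2e_c=f_c$, $J_3e_c=f_{c+3}$ for $c=1,2,3$ (with $H_0=\{J_1,J_2,J_3\}$ satisfying the quaternionic relations), and $\omega_0(e_r,e_s)=\omega_0(f_r,f_s)=0$, $\omega_0(e_r,f_s)=\delta_{rs}$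 for $1\le r,s\le6$. $\mathfrak{l}=\mathfrak{sl}(2,\mathbb{R})\subset\mathfrak{sl}(4,\mathbb{R})$ consists of the matrices with block $\begin{pmatrix}l_1&l_2\\ l_3&-l_1\end{pmatrix}$ in the lower right corner and zeros elsewhere. The reductive complement $\mathfrak{m}$ is the set of matrices $$\begin{pmatrix} a_3&a_9&a_1+a_5+a_7+a_{11}&-a_1-a_5\\ a_6&a_{12}&-2a_1-2a_{11}&a_1+a_5-a_7+a_{11}\\ a_2-a_4-a_8-a_{10}&a_8+a_{10}&-\frac12a_3-\frac12a_{12}&0\\ 2a_2-2a_{10}&-a_2-a_4+a_8+a_{10}&0&-\frac12a_3-\frac12a_{12}\end{pmatrix},\quad a_1,\dots,a_{12}\in\mathbb{R}.$$ The map $\alpha_{[\mathsf{EH}]}:\mathfrak{m}\to[\mathsf{EH}]$ sends this matrix to the vector with coordinates $(a_1,\dots,a_{12})$ in the basis $\mathcal{B}$. *)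

(* Defs.v *)
From HB Require Import structures.
From mathcomp Require Import all_boot all_order all_algebra.
From mathcomp Require Import all_classical all_reals all_analysis.

Set Implicit Arguments.
Unset Strict Implicit.
Unset Printing Implicit Defensive.

Import Order.TTheory GRing.Theory Num.Theory.
Import numFieldNormedType.Exports.

Local Open Scope classical_set_scope.
Local Open Scope ring_scope.

(* [V] is meant to be finite-dimensional: then [F] is C^(k+1) on the open set
   [U] iff it is differentiable there and all its directional derivatives are
   C^k. *)
Fixpoint Ck_on (R : realType) (V W : normedModType R) (k : nat) (U : set V)
    (F : V -> W) : Prop :=
  match k with
  | 0 => forall x, U x -> {for x, continuous F}
  | k'.+1 => (forall x, U x -> differentiable F x) /\
             (forall v : V, Ck_on k' U (fun x => 'D_v F x))
  end.

Definition smooth_on (R : realType) (V W : normedModType R) (U : set V)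
    (F : V -> W) : Prop :=
  forall k, Ck_on k U F.

Record SL4 (R : realType) : Type := MkSL4 {
  SL4val :> 'M[R]_4;
  SL4P : \det SL4val = 1 }.

Lemma SL4_mul_subproof (R : realType) (g h : SL4 R) : \det (g *m h) = 1.
Proof. by rewrite det_mulmx !SL4P mulr1. Qed.

Definition SL4mul (R : realType) (g h : SL4 R) : SL4 R :=
  MkSL4 (SL4_mul_subproof g h).

Definition SL4one (R : realType) : SL4 R := MkSL4 (det1 R 4).

Definition SL2block (R : realType) : set (SL4 R) :=
  [set h | exists2 B : 'M[R]_2, \det B = 1 &
           SL4val h = (block_mx 1%:M 0 0 B : 'M[R]_(2 + 2))].
Arguments SL2block : clear implicits.

(* SL(4,R) is a closed submanifold of the space of 4 x 4 matrices: its smooth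
   functions are those which locally extend to smooth functions of the matrix
   entries. *)
Definition smooth_SL4 (R : realType) (f : SL4 R -> R) : Prop :=
  forall g : SL4 R, exists (U : set 'M[R]_4) (F : 'M[R]_4 -> R),
    [/\ open U, U g, smooth_on U F & forall x : SL4 R, U x -> F x = f x].

Definition smooth_curve_SL4 (R : realType) (c : R -> SL4 R) : Prop :=
  smooth_on setT (fun t : R => SL4val (c t)).

Definition lcoset (R : realType) (g : SL4 R) : set (SL4 R) :=
  [set SL4mul g h | h in SL2block R].

Definition homsp (R : realType) : Type :=
  {A : set (SL4 R) | exists g, A = lcoset g}.

Definition proj (R : realType) (g : SL4 R) : homsp R :=
  exist _ (lcoset g) (ex_intro _ g erefl).

Definition origin (R : realType) : homsp R := proj (SL4one R).

Lemma SL4_inj (R : realType) (g h : SL4 R) : SL4val g = SL4val h -> g = h.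
Proof.
case: g h => [g gP] [h hP] /= eq_gh; move: gP hP; rewrite eq_gh => gP hP.
by rewrite (Prop_irrelevance gP hP).
Qed.

Lemma lcosetM (R : realType) (g k : SL4 R) :
  SL4mul g @` lcoset k = lcoset (SL4mul g k).
Proof.
rewrite /lcoset image_comp; apply: eq_imagel => h _ /=.
by apply: SL4_inj; rewrite /= mulmxA.
Qed.

Lemma act_subproof (R : realType) (g : SL4 R) (p : homsp R) :
  exists k, SL4mul g @` sval p = lcoset k.
Proof.
by case: p => A [k Ak] /=; exists (SL4mul g k); rewrite Ak lcosetM.
Qed.

Definition act (R : realType) (g : SL4 R) (p : homsp R) : homsp R :=
  exist _ (SL4mul g @` sval p) (act_subproof g p).

Lemma act_proj (R : realType) (g k : SL4 R) :
  act g (proj k) = proj (SL4mul g k).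
Proof.
rewrite /act /proj; apply: eq_exist; exact: lcosetM.
Qed.

(* The quotient manifold structure is the one for which the projection is a
   surjective submersion; a function on the quotient is smooth iff its pullback
   to the group is. *)
Definition smooth_fun (R : realType) (f : homsp R -> R) : Prop :=
  smooth_SL4 (f \o @proj R).

Definition Cinf (R : realType) : Type := {f : homsp R -> R | smooth_fun f}.

Definition smooth_curve (R : realType) (gamma : R -> homsp R) : Prop :=
  forall f : Cinf R, smooth_on setT (sval f \o gamma : R -> R).

Definition tvec (R : realType) : Type := Cinf R -> R.

Definition velocity (R : realType) (gamma : R -> homsp R) : tvec R :=
  fun f => derive1 (sval f \o gamma : R -> R) 0.

Definition tangent (R : realType) (p : homsp R) : set (tvec R) :=
  [set D | exists gamma : R -> homsp R,
     [/\ smooth_curve gamma, gamma 0 = p & D = velocity gamma]].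

(* [dproj g X D]: [X] is tangent to the group at [g] and [D] is its image under
   the differential of the projection. *)
Definition dproj (R : realType) (g : SL4 R) (X : 'M[R]_4) (D : tvec R) : Prop :=
  exists c : R -> SL4 R,
    [/\ smooth_curve_SL4 c, c 0 = g,
        is_derive (0 : R) (1 : R) (fun t : R => SL4val (c t)) X
      & D = velocity (@proj R \o c)].

Section Translation.
Variable R : realType.

Lemma Ck_on_comp_linear (V V' W : normedModType R) (L : {linear V' -> V})
    (k : nat) (U : set V) (F : V -> W) :
  continuous L -> Ck_on k U F -> Ck_on k (L @^-1` U) (F \o L).
Proof.
move=> cL; elim: k F => [|k IHk] F /=.
  move=> cF x Ux; apply: continuous_comp; first exact: cL.
  exact: cF.
move=> [dF DF]; split=> [x Ux|v].
  by apply: differentiable_comp; [exact: linear_differentiable | exact: dF].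
rewrite (_ : (fun x => _) = (fun x => 'D_(L v) F x) \o L); first exact: IHk.
apply/funext => x; rewrite /derive /=.
by under eq_fun do rewrite /= [L (_ + x)]linearD [L (_ *: _)]linearZ.
Qed.

Lemma mulmx_continuous (g : 'M[R]_4) : continuous (mulmx g : 'M[R]_4 -> 'M[R]_4).
Proof.
move=> x s /= /(nbhs_ballP (g *m x)) [e /= e0 es].
have Fx : Filter (nbhs x) by exact: nbhs_filter.
have ce i j : \forall y \near x, ball ((g *m x) i j) e ((g *m y) i j).
  have : (fun y : 'M[R]_4 => (g *m y) i j) @ x --> (g *m x) i j.
    under eq_fun do rewrite mxE.
    rewrite mxE.
    apply: (@cvg_big R^o 'I_4 +%R 0 xpredT (@add_continuous R^o) _ (nbhs x)
              (index_enum 'I_4) (fun k y => g i k * y k j)) => k _.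
    apply: (@cvgMl_tmp R _ (nbhs x) Fx); exact: coord_continuous.
  by move/cvg_ballP; apply.
have : \forall y \near x, forall ij : 'I_4 * 'I_4,
    ball ((g *m x) ij.1 ij.2) e ((g *m y) ij.1 ij.2).
  by apply: (@filter_forall 'M[R]_4 ('I_4 * 'I_4)%type (fun ij y =>
       ball ((g *m x) ij.1 ij.2) e ((g *m y) ij.1 ij.2)) (nbhs x) Fx) => -[i j];
    exact: ce.
by apply: (@filterS _ _ Fx) => y yb; apply: es; split=> // i j; exact: (yb (i, j)).
Qed.

Lemma smooth_fun_act (g : SL4 R) (f : homsp R -> R) :
  smooth_fun f -> smooth_fun (f \o act g).
Proof.
move=> sf k.
have [U [F [oU Uk sF FE]]] := sf (SL4mul g k).
have cg := @mulmx_continuous (SL4val g).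
exists (mulmx g @^-1` U), (F \o mulmx g); split => //.
- by apply: open_comp => // x _; exact: cg.
- by move=> n; apply: (@Ck_on_comp_linear _ _ _ (mulmx g)).
- by move=> x Ux /=; rewrite act_proj; exact: (FE (SL4mul g x)).
Qed.

End Translation.

Definition Cinf_act (R : realType) (g : SL4 R) (f : Cinf R) : Cinf R :=
  exist _ (sval f \o act g) (smooth_fun_act g (svalP f)).

(* The differential of the translation [act g]. *)
Definition push (R : realType) (g : SL4 R) (D : tvec R) : tvec R :=
  fun f => D (Cinf_act g f).

Definition endo_field (R : realType) : Type := homsp R -> tvec R -> tvec R.

Definition form_field (R : realType) : Type :=
  homsp R -> tvec R -> tvec R -> R.

Definition smooth_vector_field (R : realType) (X : homsp R -> tvec R) : Prop :=
  (forall p, tangent p (X p)) /\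
  (forall f : Cinf R, smooth_fun (fun p => X p f)).

Definition smooth_endo (R : realType) (J : endo_field R) : Prop :=
  [/\ (forall p D, tangent p D -> tangent p (J p D)),
      (forall p (a : R) D D', tangent p D -> tangent p D' ->
         J p (fun f => a * D f + D' f) = (fun f => a * J p D f + J p D' f))
    & (forall X, smooth_vector_field X ->
         smooth_vector_field (fun p => J p (X p)))].

Definition almost_complex (R : realType) (J : endo_field R) : Prop :=
  smooth_endo J /\
  (forall p D, tangent p D -> J p (J p D) = (fun f => - D f)).

Definition almost_hypercomplex (R : realType) (J1 J2 J3 : endo_field R) : Prop :=
  [/\ almost_complex J1, almost_complex J2, almost_complex J3
    & forall p D, tangent p D ->
        J1 p (J2 p D) = J3 p D /\ J2 p (J1 p D) = (fun f => - J3 p D f)].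

Definition two_form (R : realType) (w : form_field R) : Prop :=
  [/\ (forall p (a : R) D D' E, tangent p D -> tangent p D' -> tangent p E ->
         w p (fun f => a * D f + D' f) E = a * w p D E + w p D' E),
      (forall p D E, tangent p D -> tangent p E -> w p D E = - w p E D)
    & (forall X Y, smooth_vector_field X -> smooth_vector_field Y ->
         smooth_fun (fun p => w p (X p) (Y p)))].

Definition nondegenerate (R : realType) (w : form_field R) : Prop :=
  forall p D, tangent p D -> (forall E, tangent p E -> w p D E = 0) ->
    D = (fun _ => 0).

Definition Hermitian_for (R : realType) (J : endo_field R) (w : form_field R) :
    Prop :=
  forall p D E, tangent p D -> tangent p E -> w p (J p D) (J p E) = w p D E.

(* An SO^*(2n)-structure, i.e. an almost hypercomplex skew-Hermitian structure,
   on the homogeneous space, which has dimension 12, so that n = 3. *)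
Definition SOstar6_structure (R : realType) (J1 J2 J3 : endo_field R)
    (w : form_field R) : Prop :=
  [/\ almost_hypercomplex J1 J2 J3, two_form w, nondegenerate w
    & [/\ Hermitian_for J1 w, Hermitian_for J2 w & Hermitian_for J3 w]].

Definition invariant_endo (R : realType) (J : endo_field R) : Prop :=
  forall (g : SL4 R) p D, tangent p D ->
    J (act g p) (push g D) = push g (J p D).

Definition invariant_form (R : realType) (w : form_field R) : Prop :=
  forall (g : SL4 R) p D E, tangent p D -> tangent p E ->
    w (act g p) (push g D) (push g E) = w p D E.

(* Coordinates in the basis (e_1, .., e_6, f_1, .., f_6), cut into the four
   blocks (e_1..e_3), (e_4..e_6), (f_1..f_3), (f_4..f_6). *)
Notation EH R := 'rV[R]_((3 + 3) + (3 + 3)).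

Definition EHvec (R : realType) (x y z w : 'rV[R]_3) : EH R :=
  row_mx (row_mx x y) (row_mx z w).

Definition EHe (R : realType) (r : 'I_(3 + 3)) : EH R :=
  delta_mx 0 (lshift (3 + 3) r).
Definition EHf (R : realType) (r : 'I_(3 + 3)) : EH R :=
  delta_mx 0 (rshift (3 + 3) r).

Section Standard.
Variable R : realType.
Implicit Types a b : EH R.

Let x a : 'rV[R]_3 := lsubmx (lsubmx a).
Let y a : 'rV[R]_3 := rsubmx (lsubmx a).
Let z a : 'rV[R]_3 := lsubmx (rsubmx a).
Let w a : 'rV[R]_3 := rsubmx (rsubmx a).

(* The values on e_4, e_5, e_6 and on the f_r are forced by those on
   e_1, e_2, e_3 and the quaternionic relations. *)
Definition J1std a : EH R := EHvec (- y a) (x a) (- w a) (z a).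
Definition J2std a : EH R := EHvec (- z a) (w a) (x a) (- y a).
Definition J3std a : EH R := EHvec (- w a) (- z a) (y a) (x a).

Definition omega_std a b : R :=
  \sum_(r < 3 + 3) (lsubmx a 0 r * rsubmx b 0 r - rsubmx a 0 r * lsubmx b 0 r).

End Standard.

Section StandardFacts.
Variable R : realType.

Lemma EH_eq (a b : EH R) :
  (forall c : 'I_3, [/\ a 0 (lshift 6 (lshift 3 c)) = b 0 (lshift 6 (lshift 3 c)),
                        a 0 (lshift 6 (rshift 3 c)) = b 0 (lshift 6 (rshift 3 c)),
                        a 0 (rshift 6 (lshift 3 c)) = b 0 (rshift 6 (lshift 3 c))
                      & a 0 (rshift 6 (rshift 3 c)) = b 0 (rshift 6 (rshift 3 c))]) ->
  a = b.
Proof.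
move=> ab; apply/rowP => i.
by case: (split_ordP i) => {}i ->; case: (split_ordP i) => {}i ->;
  case: (ab i).
Qed.

Lemma J1std_e (c : 'I_3) : J1std (EHe R (lshift 3 c)) = EHe R (rshift 3 c).
Proof.
by apply: EH_eq => k; split;
  rewrite ?(row_mxEl, row_mxEr, mxE, eqxx, eq_shift, oppr0, opprK).
Qed.

Lemma J2std_e (c : 'I_3) : J2std (EHe R (lshift 3 c)) = EHf R (lshift 3 c).
Proof.
by apply: EH_eq => k; split;
  rewrite ?(row_mxEl, row_mxEr, mxE, eqxx, eq_shift, oppr0, opprK).
Qed.

Lemma J3std_e (c : 'I_3) : J3std (EHe R (lshift 3 c)) = EHf R (rshift 3 c).
Proof.
by apply: EH_eq => k; split;
  rewrite ?(row_mxEl, row_mxEr, mxE, eqxx, eq_shift, oppr0, opprK).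
Qed.

Lemma J_std_quaternionic (a : EH R) :
  [/\ J1std (J1std a) = - a, J2std (J2std a) = - a, J3std (J3std a) = - a,
      J1std (J2std a) = J3std a & J2std (J1std a) = - J3std a].
Proof.
by split; apply: EH_eq => k; split;
  rewrite ?(row_mxEl, row_mxEr, mxE, eqxx, eq_shift, oppr0, opprK).
Qed.

Lemma omega_std_basis (r s : 'I_(3 + 3)) :
  [/\ omega_std (EHe R r) (EHe R s) = 0, omega_std (EHf R r) (EHf R s) = 0,
      omega_std (EHe R r) (EHf R s) = (r == s)%:R
    & omega_std (EHf R s) (EHe R r) = - (r == s)%:R].
Proof.
rewrite /omega_std /EHe /EHf; split.
- by apply: big1 => k _; rewrite !(mxE, eq_shift) /= !(mulr0, mul0r) subr0.
- by apply: big1 => k _; rewrite !(mxE, eq_shift) /= !(mulr0, mul0r) subr0.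
- rewrite (bigD1 r) //= big1 => [|k /negbTE kr];
    rewrite !(mxE, eq_shift, eqxx) ?kr /= !(mulr0, mul0r, mul1r) subr0 //.
  by rewrite addr0.
- rewrite (bigD1 r) //= big1 => [|k /negbTE kr];
    rewrite !(mxE, eq_shift, eqxx) ?kr /= !(mulr0, mul0r, mulr1) sub0r ?oppr0 //.
  by rewrite addr0.
Qed.

End StandardFacts.

(* The inverse of alpha_[EH]: the element of m with parameters a_1, .., a_12;
   [A k] stands for a_k. *)
Definition alpha_inv (R : realType) (a : EH R) : 'M[R]_4 :=
  let A (k : nat) : R := a 0 (inord k.-1) in
  \matrix_(i, j) nth 0 (nth [::] [::
    [:: A 3; A 9; A 1 + A 5 + A 7 + A 11; - A 1 - A 5];
    [:: A 6; A 12; - 2 * A 1 - 2 * A 11; A 1 + A 5 - A 7 + A 11];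
    [:: A 2 - A 4 - A 8 - A 10; A 8 + A 10; - 2^-1 * A 3 - 2^-1 * A 12; 0];
    [:: 2 * A 2 - 2 * A 10; - A 2 - A 4 + A 8 + A 10; 0;
        - 2^-1 * A 3 - 2^-1 * A 12]] i) j.

(* Main.v *)
(* Put e = diag(1,1,0,0). An element h of SL(4) lies in the block SL(2) iff
   h e = e h = e, so the entries of g e and e g^-1 are smooth functions on the
   quotient, and they separate its points: the stabilizer of (e, e) is SL(2).
   A curve gamma through the origin is therefore governed by the pair of matrix
   curves (A, B) = (g e, e g^-1), and near 0 it lifts to SL(4) by the explicit
   section A + (1 - A B)(1 - e), corrected by a diagonal factor to have
   determinant 1. Thus every tangent vector at the origin is the image of a
   trace zero matrix, and of a unique element of m since the differential of the
   projection kills exactly l. Left translation gives frames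
   iotag g : [EH] -> T_{gL}, whose coordinates are recovered from the values of
   the vector on the entries of g e and e g^-1; this makes invariant tensors
   smooth. Two frames over the same point differ by Ad(h), h in SL(2). On [EH]
   this fixes the third quaternionic line pointwise and mixes the first two by
   an H_0-linear map whose coefficients satisfy t^2 - u^2 + v^2 - w^2 = det h = 1,
   whence it preserves omega_0. *)
Require Import Defs.
From HB Require Import structures.
From mathcomp Require Import all_boot all_order all_algebra.
From mathcomp Require Import all_classical all_reals all_analysis.
From mathcomp Require Import perm ring.

Set Implicit Arguments.
Unset Strict Implicit.
Unset Printing Implicit Defensive.

Import Order.TTheory GRing.Theory Num.Theory.
Import numFieldNormedType.Exports.

Local Open Scope classical_set_scope.
Local Open Scope ring_scope.

(* MathComp-Analysis also has a [proj], for product topologies. *)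
Local Notation proj := Defs.proj.

(** * Calculus of C^k maps *)

Section CkGeneral.
Context {R : realType} {V W : normedModType R}.
Implicit Types (F G : V -> W) (U D : set V) (k : nat).

(** The first order expansion at [x] only involves the germ of the map, and [diff_unique] identifies
    its linear part with the differential. *)
Lemma near_eq_differentiable F G x :
  (\forall y \near x, F y = G y) -> differentiable F x -> differentiable G x.
Proof.
move=> FG dF; have /diff_locallyP[c E] := dF.
have e : G \o shift x = cst (G x) + 'd F x +o_ 0 id.
  apply/eqaddoP => _/posnumP[e].
  have /eqaddoP/(_ e%:num [gt0 of e%:num]) := E.
  have : \forall y \near 0, F (shift x y) = G (shift x y).
    move: FG; rewrite (near_shift 0 x) subr0; exact: filterS.
  by apply: filterS2 => y /= Fy; rewrite !fctE /= (nbhs_singleton FG) Fy.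
apply/diff_locallyP.
by have -> := @diff_unique _ _ _ G ('d F x) x c e.
Qed.

(** Derivatives are those of the ambient map, so being C^k on [U] is a condition at each point of
    [U], and the covering sets can be arbitrary. *)
Lemma Ck_on_local k U F :
  (forall x, U x -> exists2 D, D x & Ck_on k D F) -> Ck_on k U F.
Proof.
elim: k F => [|k IHk] F /= H.
  by move=> x /H[D Dx]; apply.
split=> [x /H[D Dx [dF _]]|v]; first exact: dF.
by apply: IHk => x /H[D Dx [_ DF]]; exists D.
Qed.

Lemma Ck_on_sub k U D F : D `<=` U -> Ck_on k U F -> Ck_on k D F.
Proof. by move=> DU CF; apply: Ck_on_local => x /DU Ux; exists U. Qed.

(** Openness turns equality on [U] into equality of germs at each point, which is what derivatives
    see. *)
Lemma Ck_on_eq k U F G : open U -> (forall x, U x -> F x = G x) ->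
  Ck_on k U F -> Ck_on k U G.
Proof.
move=> oU; elim: k F G => [|k IHk] F G FG /=.
  move=> cF x Ux; change (G @ x --> G x); rewrite -(FG x Ux).
  apply: (cvg_trans _ (cF x Ux)); apply: near_eq_cvg.
  by apply: filterS (open_nbhs_nbhs (conj oU Ux)) => y /FG.
have nFG x : U x -> \forall y \near x, F y = G y.
  by move=> Ux; apply: filterS (open_nbhs_nbhs (conj oU Ux)) => y /FG.
move=> [dF DF]; split=> [x Ux|v].
  by apply: near_eq_differentiable (nFG x Ux) (dF x Ux).
apply: IHk (DF v) => x Ux; exact: near_eq_derive (nFG x Ux).
Qed.

Lemma Ck_onW k U F : Ck_on k.+1 U F -> Ck_on k U F.
Proof.
elim: k F => [|k IHk] F [dF DF] /=.
  by move=> x Ux; apply: differentiable_continuous; exact: dF.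
by split=> // v; exact/IHk/DF.
Qed.

Lemma Ck_on_cst k U (w : W) : Ck_on k U (fun=> w : W).
Proof.
elim: k w => [|k IHk] w /=; first by move=> x _; exact: cvg_cst.
split=> [x _|v]; first exact: differentiable_cst.
have -> : (fun x => 'D_v (fun=> w) x) = (fun=> 0) :> (V -> W).
  by apply/funext => x; exact: derive_cst.
exact: IHk.
Qed.

Lemma Ck_onD k U F G : open U -> Ck_on k U F -> Ck_on k U G ->
  Ck_on k U (fun x => F x + G x).
Proof.
move=> oU; elim: k F G => [|k IHk] F G /=.
  by move=> cF cG x Ux; apply: cvgD; [exact: cF|exact: cG].
move=> [dF DF] [dG DG]; split=> [x Ux|v].
  by apply: differentiableD; [exact: dF|exact: dG].
apply: (Ck_on_eq oU _ (IHk _ _ (DF v) (DG v))) => x Ux.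
by rewrite [RHS]deriveD//; apply: diff_derivable; [exact: dF|exact: dG].
Qed.

Lemma Ck_on_linear k U (L : {linear V -> W}) : continuous L -> Ck_on k U L.
Proof.
move=> cL; case: k => [|k] /=; first by move=> x _; exact: cL.
split=> [x _|v]; first exact: linear_differentiable.
have -> : (fun x => 'D_v L x) = (fun=> L v) :> (V -> W); last exact: Ck_on_cst.
by apply/funext => x; rewrite deriveE ?diff_lin//; exact: linear_differentiable.
Qed.

End CkGeneral.

Section CkPost.
Context {R : realType} {V W W' : normedModType R}.

Lemma Ck_on_post k (U : set V) (L : {linear W -> W'}) (F : V -> W) :
  open U -> continuous L -> Ck_on k U F -> Ck_on k U (fun x => L (F x)).
Proof.
move=> oU cL; elim: k F => [|k IHk] F /=.
  by move=> cF x Ux; apply: continuous_comp; [exact: cF|exact: cL].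
move=> [dF DF]; split=> [x Ux|v].
  by apply: (@differentiable_comp _ _ _ _ F L); [exact: dF|exact: linear_differentiable].
apply: (Ck_on_eq oU _ (IHk _ (DF v))) => x Ux.
have dL : differentiable L (F x) by exact: linear_differentiable.
rewrite (deriveE _ (dF x Ux)) (deriveE _ (@differentiable_comp _ _ _ _ F L x (dF x Ux) dL)).
by rewrite [RHS](_ : _ = ('d (L \o F) x) v)// (@diff_comp _ _ _ _ F L) ?diff_lin//; exact: dF.
Qed.

End CkPost.

Section CkReal.
Context {R : realType} {V : normedModType R}.
Implicit Types (F G : V -> R) (U : set V) (k : nat).

(** By Leibniz the derivative contains [F] and [G] themselves, so the induction also lowers their
    order by [Ck_onW]. *)
Lemma Ck_onM k U F G : open U -> Ck_on k U F -> Ck_on k U G ->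
  Ck_on k U (fun x => F x * G x).
Proof.
move=> oU; elim: k F G => [|k IHk] F G.
  by move=> cF cG x Ux; apply: cvgM; [exact: cF|exact: cG].
move=> CF CG; have [[dF DF] [dG DG]] := (CF, CG); split=> [x Ux|v].
  by apply: differentiableM; [exact: dF|exact: dG].
apply: (@Ck_on_eq _ _ _ _ _ (fun x => F x * 'D_v G x + G x * 'D_v F x)) => //.
  move=> x Ux.
  by have -> := deriveM (@diff_derivable _ _ _ _ _ v (dF x Ux))
                  (@diff_derivable _ _ _ _ _ v (dG x Ux)).
apply: Ck_onD => //; apply: IHk.
- exact: Ck_onW CF.
- exact: DG.
- exact: Ck_onW CG.
- exact: DF.
Qed.

End CkReal.

Section CkBig.
Context {R : realType} {V W : normedModType R}.

Lemma Ck_on_sum k (I : Type) (r : seq I) (P : pred I) (U : set V) (F : I -> V -> W) :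
  open U -> (forall i, P i -> Ck_on k U (F i)) ->
  Ck_on k U (fun x => \sum_(i <- r | P i) F i x).
Proof.
move=> oU CF; elim: r => [|i r IHr].
  have -> : (fun x => \sum_(j <- [::] | P j) F j x) = cst 0.
    by apply/funext => x; rewrite big_nil.
  exact: Ck_on_cst.
have -> : (fun x => \sum_(j <- i :: r | P j) F j x) =
    if P i then fun x => F i x + \sum_(j <- r | P j) F j x
    else fun x => \sum_(j <- r | P j) F j x.
  by apply/funext => x; rewrite big_cons; case: ifP.
by case: ifP => // Pi; apply: Ck_onD => //; exact: CF.
Qed.

Lemma Ck_on_prod k (I : Type) (r : seq I) (P : pred I) (U : set V)
  (F : I -> V -> R) :
  open U -> (forall i, P i -> Ck_on k U (F i)) ->
  Ck_on k U (fun x => \prod_(i <- r | P i) F i x).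
Proof.
move=> oU CF; elim: r => [|i r IHr].
  have -> : (fun x => \prod_(j <- [::] | P j) F j x) = cst 1.
    by apply/funext => x; rewrite big_nil.
  exact: Ck_on_cst.
have -> : (fun x => \prod_(j <- i :: r | P j) F j x) =
    if P i then fun x => F i x * \prod_(j <- r | P j) F j x
    else fun x => \prod_(j <- r | P j) F j x.
  by apply/funext => x; rewrite big_cons; case: ifP.
by case: ifP => // Pi; apply: Ck_onM => //; exact: CF.
Qed.

Lemma Ck_on_coord k m n (i : 'I_m) (j : 'I_n) (U : set 'M[R]_(m, n)) :
  Ck_on k U (fun A : 'M[R]_(m, n) => A i j : R).
Proof.
have @f : {linear 'M[R]_(m, n) -> R}.
  by exists (fun N : 'M[R]_(_, _) => N i j); do 2![eexists]; do ?[constructor];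
     rewrite ?mxE// => ? *; rewrite ?mxE//; move=> ?; rewrite !mxE.
apply: (@Ck_on_linear _ _ _ k U f) => x; exact: coord_continuous.
Qed.

End CkBig.

Section CkMatrix.
Context {R : realType} {V : normedModType R}.

Lemma Ck_on_mx k m n (U : set V) (F : V -> 'M[R]_(m, n)) : open U ->
  (forall i j, Ck_on k U (fun x => F x i j)) -> Ck_on k U F.
Proof.
move=> oU CF.
have -> : F = fun x => \sum_i \sum_j F x i j *: delta_mx i j.
  by apply/funext => x; exact: matrix_sum_delta.
apply: Ck_on_sum => // i _; apply: Ck_on_sum => // j _.
have @L : {linear R^o -> 'M[R]_(m, n)}.
  exists (fun r : R^o => r *: delta_mx i j); do 2![eexists]; do ?[constructor].
  - by rewrite scale0r.
  - by move=> r s; rewrite scalerDl.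
  - by move=> r s; rewrite scalerA.
have cL : continuous L by move=> x; exact: scalel_continuous.
exact: (@Ck_on_post R V R^o 'M[R]_(m, n) k U L (fun x => F x i j) oU cL (CF i j)).
Qed.

Lemma Ck_on_entry k m n (U : set V) (F : V -> 'M[R]_(m, n)) i j : open U ->
  Ck_on k U F -> Ck_on k U (fun x => F x i j).
Proof.
move=> oU CF.
have @f : {linear 'M[R]_(m, n) -> R}.
  by exists (fun N : 'M[R]_(_, _) => N i j); do 2![eexists]; do ?[constructor];
     rewrite ?mxE// => ? *; rewrite ?mxE//; move=> ?; rewrite !mxE.
apply: (@Ck_on_post _ _ _ _ k U f _ oU _ CF) => x; exact: coord_continuous.
Qed.

Lemma differentiable_sum_delta m n (F : 'M[R]_(m, n) -> R) x A :
  differentiable F x -> 'D_A F x = \sum_i \sum_j A i j * 'D_(delta_mx i j) F x.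
Proof.
move=> dF; rewrite deriveE// {1}(matrix_sum_delta A) linear_sum.
apply: eq_bigr => i _; rewrite linear_sum; apply: eq_bigr => j _.
by rewrite linearZ deriveE.
Qed.

Lemma derive_comp m n (F : 'M[R]_(m, n) -> R) (c : V -> 'M[R]_(m, n)) x v :
  differentiable F (c x) -> differentiable c x ->
  'D_v (fun y => F (c y)) x = 'D_('D_v c x) F (c x).
Proof.
move=> dF dc; rewrite (@deriveE _ _ _ (F \o c)); last exact: differentiable_comp.
by rewrite diff_comp// !deriveE.
Qed.

(** The direction ['D_v c x] varies with [x]. Expanding it in the matrix units leaves derivatives of
    [F] in fixed directions, to which the induction hypothesis applies. *)
Lemma Ck_on_comp k m n (F : 'M[R]_(m, n) -> R) (c : V -> 'M[R]_(m, n)) U D :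
  open U -> open D -> D `<=` c @^-1` U -> Ck_on k U F -> Ck_on k D c ->
  Ck_on k D (fun x => F (c x)).
Proof.
move=> oU oD DU; elim: k F c DU => [|k IHk] F c DU.
  move=> cF cc x Dx; apply: (continuous_comp (f := c)); first exact: cc.
  exact/cF/DU.
move=> [dF DF] Cc; have [dc Dc] := Cc; split=> [x Dx|v].
  by apply: (differentiable_comp (f := c)); [exact: dc|exact/dF/DU].
apply: (@Ck_on_eq _ _ _ _ _
  (fun x => \sum_i \sum_j 'D_v c x i j * 'D_(delta_mx i j) F (c x)) _ oD).
  move=> x Dx; rewrite derive_comp; [|exact/dF/DU|exact: dc].
  by rewrite -differentiable_sum_delta//; exact/dF/DU.
apply: Ck_on_sum => // i _; apply: Ck_on_sum => // j _; apply: Ck_onM => //.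
  by apply: Ck_on_entry => //; exact: Dc.
by apply: (IHk ('D_(delta_mx i j) F) c DU); [exact: DF|exact: Ck_onW].
Qed.

End CkMatrix.

(** * Smooth functions on SL(4) *)

Section MatrixDerive.
Context {R : realType} {V : normedModType R}.

Lemma is_derive_mxP m n (F : V -> 'M[R]_(m, n)) A x v :
  is_derive x v F A <-> forall i j, is_derive x v (fun y => F y i j) (A i j).
Proof.
split=> [[dF <-] i j|H].
  split; first by have /derivable_mxP := dF; apply.
  by rewrite derive_mx// mxE.
have dF : derivable F x v by apply/derivable_mxP => i j; have [] := H i j.
split=> //; rewrite derive_mx//; apply/matrixP => i j; rewrite mxE.
by have [] := H i j.
Qed.

Lemma is_derive_mulmx m n p (F : V -> 'M[R]_(m, n)) (G : V -> 'M[R]_(n, p))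
  A B x v : is_derive x v F A -> is_derive x v G B ->
  is_derive x v (fun y => F y *m G y) (A *m G x + F x *m B).
Proof.
move=> /is_derive_mxP FA /is_derive_mxP GB; apply/is_derive_mxP => i j.
have -> : (fun y => (F y *m G y) i j) =
    \sum_k ((fun y => F y i k) * (fun y => G y k j)).
  by apply/funext => y; rewrite mxE fct_sumE.
have H k : is_derive x v ((fun y => F y i k : R) * (fun y => G y k j : R))
    (F x i k *: B k j + G x k j *: A i k).
  exact: is_deriveM.
apply: (is_derive_eq (is_derive_sum H)).
rewrite !mxE -big_split/=; apply: eq_bigr => k _.
by rewrite addrC; congr (_ + _); exact: mulrC.
Qed.

End MatrixDerive.

Section SL4calc.
Variable R : realType.
Implicit Types (g h k : SL4 R) (X Y : 'M[R]_4) (f : Cinf R).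

Lemma smooth_SL4_ext (F : 'M[R]_4 -> R) :
  smooth_on setT F -> smooth_SL4 (fun g => F g).
Proof. by move=> sF g; exists setT, F; split => //; exact: openT. Qed.

Lemma smooth_SL4_cst (a : R) : smooth_SL4 (fun=> a).
Proof. by apply: smooth_SL4_ext => k; exact: Ck_on_cst. Qed.

Lemma smooth_SL4D (F G : SL4 R -> R) : smooth_SL4 F -> smooth_SL4 G ->
  smooth_SL4 (fun g => F g + G g).
Proof.
move=> sF sG g.
have [U [F' [oU Ug CF FE]]] := sF g; have [D [G' [oD Dg CG GE]]] := sG g.
exists (U `&` D), (fun x => F' x + G' x); split=> //; first exact: openI.
- move=> k; apply: Ck_onD; first exact: openI.
    exact: Ck_on_sub (CF k).
  exact: Ck_on_sub (CG k).
- by move=> x [Ux Dx]; rewrite FE ?GE.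
Qed.

Lemma smooth_SL4M (F G : SL4 R -> R) : smooth_SL4 F -> smooth_SL4 G ->
  smooth_SL4 (fun g => F g * G g).
Proof.
move=> sF sG g.
have [U [F' [oU Ug CF FE]]] := sF g; have [D [G' [oD Dg CG GE]]] := sG g.
exists (U `&` D), (fun x => F' x * G' x); split=> //; first exact: openI.
- move=> k; apply: Ck_onM; first exact: openI.
    exact: Ck_on_sub (CF k).
  exact: Ck_on_sub (CG k).
- by move=> x [Ux Dx]; rewrite FE ?GE.
Qed.

Lemma smooth_SL4N (F : SL4 R -> R) : smooth_SL4 F -> smooth_SL4 (fun g => - F g).
Proof.
move=> sF; rewrite (_ : (fun g => - F g) = fun g => -1 * F g).
  by apply: smooth_SL4M => //; exact: smooth_SL4_cst.
by apply/funext => g; rewrite mulN1r.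
Qed.

Lemma smooth_SL4_sum (I : Type) (r : seq I) (F : I -> SL4 R -> R) :
  (forall i, smooth_SL4 (F i)) -> smooth_SL4 (fun g => \sum_(i <- r) F i g).
Proof.
move=> sF; elim: r => [|i r IHr].
  rewrite (_ : (fun g => _) = fun=> 0); first exact: smooth_SL4_cst.
  by apply/funext => g; rewrite big_nil.
rewrite (_ : (fun g => _) = fun g => F i g + \sum_(i <- r) F i g).
  exact: smooth_SL4D.
by apply/funext => g; rewrite big_cons.
Qed.

Definition smooth_mx m n (F : SL4 R -> 'M[R]_(m, n)) :=
  forall i j, smooth_SL4 (fun g => F g i j).

Lemma smooth_mx_mul m n p (F : SL4 R -> 'M[R]_(m, n)) (G : SL4 R -> 'M[R]_(n, p)) :
  smooth_mx F -> smooth_mx G -> smooth_mx (fun g => F g *m G g).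
Proof.
move=> sF sG i j; rewrite (_ : (fun g => _) = fun g => \sum_k F g i k * G g k j).
  by apply: smooth_SL4_sum => k; exact: smooth_SL4M.
by apply/funext => g; rewrite mxE.
Qed.

Lemma smooth_mx_cst m n (A : 'M[R]_(m, n)) : smooth_mx (fun=> A).
Proof. by move=> i j; exact: smooth_SL4_cst. Qed.

Lemma smooth_mxB m n (F G : SL4 R -> 'M[R]_(m, n)) :
  smooth_mx F -> smooth_mx G -> smooth_mx (fun g => F g - G g).
Proof.
move=> sF sG i j; rewrite (_ : (fun g => _) = fun g => F g i j - G g i j).
  by apply: smooth_SL4D => //; exact: smooth_SL4N.
by apply/funext => g; rewrite !mxE.
Qed.

Lemma smooth_mx_val : smooth_mx (@SL4val R).
Proof. by move=> i j; apply: (@smooth_SL4_ext (fun A => A i j)) => k; exact: Ck_on_coord. Qed.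

(** Cofactors are polynomials in the entries. On SL(4) the adjugate is the inverse, so writing
    inverses as [\adj g] gives them a smooth extension to all matrices. *)
Lemma Ck_on_adj (k : nat) (U : set 'M[R]_4) i j : open U ->
  Ck_on k U (fun A : 'M[R]_4 => \adj A i j : R).
Proof.
move=> oU; have -> : (fun A : 'M[R]_4 => \adj A i j) = fun A : 'M[R]_4 =>
    (-1) ^+ (j + i) * \sum_(s : 'S_3) (-1) ^+ s *
       \prod_l A (lift j l) (lift i (s l)).
  apply/funext => A; rewrite !mxE /cofactor /determinant; congr (_ * _).
  by apply: eq_bigr => s _; congr (_ * _); apply: eq_bigr => l _; rewrite !mxE.
apply: Ck_onM => //; first exact: Ck_on_cst.
apply: Ck_on_sum => // s _; apply: Ck_onM => //; first exact: Ck_on_cst.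
by apply: Ck_on_prod => // l _; exact: Ck_on_coord.
Qed.

Lemma smooth_mx_adj : smooth_mx (fun g => \adj g).
Proof.
move=> i j; apply: (@smooth_SL4_ext (fun A => \adj A i j)) => k.
by apply: Ck_on_adj; exact: openT.
Qed.

Lemma SL4_mulVmx g : \adj g *m g = 1%:M.
Proof. by rewrite mul_adj_mx SL4P. Qed.

Lemma SL4_mulmxV g : g *m \adj g = 1%:M.
Proof. by rewrite mul_mx_adj SL4P. Qed.

Lemma SL4_inv_subproof g : \det (\adj g) = 1.
Proof. by have /(congr1 determinant) := SL4_mulVmx g; rewrite det_mulmx SL4P mulr1 det1. Qed.

Definition SL4inv g : SL4 R := MkSL4 (SL4_inv_subproof g).

Lemma SL4_mulmxI g (A B : 'M[R]_4) : g *m A = B -> A = \adj g *m B.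
Proof. by move=> <-; rewrite mulmxA SL4_mulVmx mul1mx. Qed.

Lemma smooth_mx_linear m n m' n' (L : {linear 'M[R]_(m, n) -> 'M[R]_(m', n')})
  (F : SL4 R -> 'M[R]_(m, n)) : smooth_mx F -> smooth_mx (fun g => L (F g)).
Proof.
move=> sF i j; have -> : (fun g => L (F g) i j) =
    fun g => \sum_k \sum_l F g k l * L (delta_mx k l) i j.
  apply/funext => g; rewrite {1}(matrix_sum_delta (F g)) linear_sum summxE.
  apply: eq_bigr => k _; rewrite linear_sum summxE; apply: eq_bigr => l _.
  by rewrite linearZ mxE.
apply: smooth_SL4_sum => k; apply: smooth_SL4_sum => l.
by apply: smooth_SL4M => //; exact: smooth_SL4_cst.
Qed.

End SL4calc.

Section MatrixCk.
Context {R : realType} {V : normedModType R}.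

Lemma Ck_on_mulmx k m n p (U : set V) (F : V -> 'M[R]_(m, n)) (G : V -> 'M[R]_(n, p)) :
  open U -> Ck_on k U F -> Ck_on k U G -> Ck_on k U (fun x => F x *m G x).
Proof.
move=> oU CF CG; apply: Ck_on_mx => // i j.
have -> : (fun x => (F x *m G x) i j) = fun x => \sum_l F x i l * G x l j.
  by apply/funext => x; rewrite mxE.
by apply: Ck_on_sum => // l _; apply: Ck_onM => //; exact: Ck_on_entry.
Qed.

End MatrixCk.

Section RealCk.
Variable R : realType.

Lemma Ck_on_id k (U : set R) : Ck_on k U (id : R -> R).
Proof.
case: k => [|k] /=; first by move=> x _; exact: cvg_id.
split=> // v; have -> : (fun x : R => 'D_v id x) = fun=> v.
  by apply/funext => x; rewrite derive_id.
exact: Ck_on_cst.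
Qed.

Lemma is_derive_mulr (a x : R) : is_derive x 1 (fun t => t * a) a.
Proof.
have H : is_derive x 1 (id * cst a) (id x *: 0 + a *: 1) by exact: is_deriveM.
by apply: (is_derive_eq H); rewrite scaler0 add0r; exact: mulr1.
Qed.

(** The direction [v] is arbitrary because [Ck_on] quantifies over all directions, also on the
    line. *)
Lemma is_derive_expRM (a x v : R) :
  is_derive x v (fun t => expR (t * a)) (v * a * expR (x * a)).
Proof.
have d0 := is_derive_mulr a x.
have d : is_derive x 1 (fun t => expR (t * a)) (expR (x * a) * a).
  have := @is_derive1_comp R expR (fun t => t * a) x (expR (x * a)) a (is_derive_expR _) d0.
  exact.
have df : differentiable (fun t : R => expR (t * a)) x by apply/derivable1_diffP.
split; first exact: diff_derivable.
rewrite deriveE// -[v]mulr1 [LHS]linearZ/= -deriveE// derive_val mulr1.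
by rewrite -mulrA [a * _]mulrC.
Qed.

Lemma Ck_on_expRM k (U : set R) (a : R) : open U ->
  Ck_on k U (fun t => expR (t * a)).
Proof.
move=> oU; elim: k => [|k IHk] /=.
  move=> x _; apply: differentiable_continuous.
  by apply/derivable1_diffP; have [] := is_derive_expRM a x 1.
split=> [x _|v].
  by apply/derivable1_diffP; have [] := is_derive_expRM a x 1.
have -> : (fun x : R => 'D_v (fun t : R => expR (t * a)) x) =
    fun x : R => v * a * expR (x * a).
  by apply/funext => x; have [_ ->] := is_derive_expRM a x v.
by apply: Ck_onM => //; exact: Ck_on_cst.
Qed.

End RealCk.

(** * Curves in SL(4) with prescribed velocity *)

Section LDU.
Variable R : realType.
Implicit Types (X : 'M[R]_4) (t : R).

Definition lower X : 'M[R]_4 := \matrix_(i, j) if (j < i)%N then X i j else 0.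
Definition dexp X t : 'rV[R]_4 := \row_i expR (t * X i i).
(* An elementary substitute for [exp (t X)]: for trace zero [X] this curve lies in
   SL(4) and has derivative [X] at 0. *)
Definition LDU X t : 'M[R]_4 :=
  (1%:M + t *: lower X) *m diag_mx (dexp X t) *m (1%:M + t *: lower X^T)^T.

Lemma det_lower X t : \det (1%:M + t *: lower X) = 1.
Proof.
rewrite det_trig; first by rewrite big1 // => i _; rewrite !mxE eqxx ltnn mulr0 addr0.
apply/is_trig_mxP => i j ij; rewrite !mxE ltnNge (ltnW ij) /= mulr0 addr0.
by case: eqP ij => // ->; rewrite ltnn.
Qed.

Lemma det_LDU X t : \tr X = 0 -> \det (LDU X t) = 1.
Proof.
move=> trX; rewrite !det_mulmx det_tr !det_lower mul1r mulr1 det_diag.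
under eq_bigr do rewrite mxE.
by rewrite -expR_sum -mulr_sumr -[\sum_i _]/(\tr X) trX mulr0 expR0.
Qed.

Lemma LDU0 X : LDU X 0 = 1%:M.
Proof.
rewrite /LDU !scale0r !addr0 trmx1 mul1mx mulmx1.
by apply/matrixP => i j; rewrite !mxE mul0r expR0.
Qed.

(** The summands are the derivatives at 0 of the three factors of [LDU X]. *)
Lemma LDU_split X :
  lower X + diag_mx (\row_i X i i) + (lower X^T)^T = X.
Proof.
apply/matrixP => i j; rewrite !mxE.
case: (ltngtP i j) => [ij|ij|/val_inj ->]; last by rewrite eqxx addr0 add0r.
  by case: eqP ij => [->|_ _]; rewrite ?ltnn// mulr0n addr0 add0r.
by case: eqP ij => [->|_ _]; rewrite ?ltnn// mulr0n !addr0.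
Qed.

Lemma is_derive_affine m n (A B : 'M[R]_(m, n)) t :
  is_derive t 1 (fun s => A + s *: B) B.
Proof.
apply/is_derive_mxP => i j.
have -> : (fun y : R => (A + y *: B) i j) = cst (A i j) + (fun y : R => y * B i j).
  by apply/funext => y; rewrite !mxE.
have H := is_deriveD (is_derive_cst (A i j) t 1) (is_derive_mulr (B i j) t).
by apply: (is_derive_eq H); rewrite add0r.
Qed.

Lemma is_derive_LDU X : is_derive (0 : R) 1 (LDU X) X.
Proof.
have d1 := is_derive_affine 1%:M (lower X) 0.
have d3 := is_derive_affine 1%:M (lower X^T)^T 0.
have d2 : is_derive (0 : R) 1 (fun t => diag_mx (dexp X t)) (diag_mx (\row_i X i i)).
  apply/is_derive_mxP => i j.
  have -> : (fun t => diag_mx (dexp X t) i j) =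
      (fun t => (i == j)%:R * expR (t * X i i)).
    by apply/funext => t; rewrite !mxE; case: eqP => [->|_]; rewrite ?mul0r ?mul1r.
  have H := is_deriveM (is_derive_cst ((i == j)%:R : R) (0 : R) 1)
    (is_derive_expRM (X i i) 0 1).
  apply: (is_derive_eq H).
  rewrite scaler0 addr0 mul0r expR0 mul1r mulr1 !mxE /cst.
  by case: eqP => [->|_]; [exact: mul1r|exact: mul0r].
have -> : LDU X = fun t =>
  (1%:M + t *: lower X) *m diag_mx (dexp X t) *m (1%:M + t *: (lower X^T)^T).
  by apply/funext => t; rewrite /LDU linearD linearZ/= trmx1.
apply: (is_derive_eq (is_derive_mulmx (is_derive_mulmx d1 d2) d3)).
rewrite !scale0r !addr0 !mul1mx !mulmx1.
have -> : diag_mx (dexp X 0) = 1%:M.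
  by apply/matrixP => i j; rewrite !mxE mul0r expR0.
by rewrite mulmx1 mul1mx LDU_split.
Qed.

Lemma smooth_LDU X : smooth_on setT (LDU X).
Proof.
move=> k; have oT := @openT R.
have Ca (A B : 'M[R]_4) : Ck_on k setT (fun t : R => A + t *: B).
  apply: Ck_on_mx => // i j.
  have -> : (fun y : R => (A + y *: B) i j) = fun y => A i j + y * B i j.
    by apply/funext => y; rewrite !mxE.
  apply: Ck_onD => //; first exact: Ck_on_cst.
  by apply: Ck_onM => //; [exact: Ck_on_id|exact: Ck_on_cst].
have -> : LDU X = fun t =>
  (1%:M + t *: lower X) *m diag_mx (dexp X t) *m (1%:M + t *: (lower X^T)^T).
  by apply/funext => t; rewrite /LDU linearD linearZ/= trmx1.
apply: Ck_on_mulmx => //; apply: Ck_on_mulmx => //.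
apply: Ck_on_mx => // i j.
have -> : (fun t => diag_mx (dexp X t) i j) =
    (fun t => (i == j)%:R * expR (t * X i i)).
  by apply/funext => t; rewrite !mxE; case: eqP => [->|_]; rewrite ?mul0r ?mul1r.
by apply: Ck_onM => //; [exact: Ck_on_cst|exact: Ck_on_expRM].
Qed.

Definition SLcurve X (trX : \tr X = 0) t : SL4 R := MkSL4 (det_LDU t trX).

End LDU.

(** * The differential of the projection *)

Section Velocity.
Variable R : realType.
Implicit Types (g h k : SL4 R) (X Y : 'M[R]_4) (f : Cinf R).

Definition is_ext f (U : set 'M[R]_4) (F : 'M[R]_4 -> R) :=
  [/\ open U, smooth_on U F & forall x : SL4 R, U x -> F x = sval f (proj x)].

Lemma ext_exists f g : exists UF : set 'M[R]_4 * ('M[R]_4 -> R),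
  UF.1 g /\ is_ext f UF.1 UF.2.
Proof. by have [U [F [oU Ug CF FE]]] := svalP f g; exists (U, F). Qed.

Definition ext f g : 'M[R]_4 -> R := (sval (cid (ext_exists f g))).2.

Lemma extP f g : exists2 U, U (SL4val g) & is_ext f U (ext f g).
Proof.
by rewrite /ext; case: cid => -[U F] /= [Ug UF]; exists U.
Qed.

Lemma smooth_on_diff (V W : normedModType R) (U : set V) (F : V -> W) x :
  smooth_on U F -> U x -> differentiable F x.
Proof. by move=> /(_ 1%N)[dF _]; exact: dF. Qed.

(* Only the germ at 0 matters, so that local sections suffice. *)
Definition is_lift (gamma : R -> homsp R) (c : R -> 'M[R]_4) :=
  \forall t \near 0, exists2 s : SL4 R, SL4val s = c t & gamma t = proj s.

(** Near 0 the lift stays in [U], where [f] along [gamma] is [F \o c], and the chain rule applies.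
    The left side does not mention [F], which makes derivatives in tangential directions independent
    of the extension. *)
Lemma velocity_ext f (U : set 'M[R]_4) F gamma c Y :
  is_ext f U F -> U (c 0) -> is_lift gamma c -> is_derive (0 : R) 1 c Y ->
  velocity gamma f = 'D_Y F (c 0).
Proof.
move=> [oU CF FE] Uc0 lc [dc DY].
have dc0 : differentiable c 0 by apply/derivable1_diffP.
have cU : \forall t \near 0, U (c t).
  by apply: (differentiable_continuous dc0); exact: open_nbhs_nbhs.
rewrite /velocity derive1E -[in RHS]DY -derive_comp//; last exact: smooth_on_diff Uc0.
apply: near_eq_derive; near=> t.
have [s sc gs] : exists2 s : SL4 R, SL4val s = c t & gamma t = proj s.
  by near: t.
have Uct : U (c t) by near: t.
by rewrite /= -sc FE ?sc// -gs.
Unshelve. all: by end_near. Qed.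

(* The differential of the projection at [g], for [X] tangent to SL(4) at [g];
   for other [X] the value depends on the chosen extension. *)
Definition dpr g X : tvec R := fun f => 'D_X (ext f g) g.

Lemma velocity_lift g gamma (c : R -> 'M[R]_4) Y : c 0 = SL4val g -> is_lift gamma c ->
  is_derive (0 : R) 1 c Y -> velocity gamma = dpr g Y.
Proof.
move=> c0 lc dc; apply/funext => f; have [U Ug UF] := extP f g.
by rewrite /dpr -c0; apply: (velocity_ext UF _ lc dc); rewrite c0.
Qed.

Lemma dprP g (t : R) X Y f : dpr g (t *: X + Y) f = t * dpr g X f + dpr g Y f.
Proof.
have [U Ug [_ CF _]] := extP f g.
by rewrite /dpr !deriveE ?linearP//; exact: smooth_on_diff CF Ug.
Qed.

Lemma smooth_curve_proj (c : R -> SL4 R) :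
  smooth_curve_SL4 c -> smooth_curve (@proj R \o c).
Proof.
move=> sc f k; apply: Ck_on_local => t _.
have [U Uct [oU CF FE]] := extP f (c t).
have oD : open ((fun t => SL4val (c t)) @^-1` U).
  by apply: open_comp => // x _; exact: (sc 0%N).
exists ((fun t => SL4val (c t)) @^-1` U) => //.
apply: (Ck_on_eq oD _ (Ck_on_comp oU oD _ (CF k) (Ck_on_sub _ (sc k)))) => //.
by move=> x Ux /=; exact: FE.
Qed.

Lemma smooth_curve_act g gamma : smooth_curve gamma -> smooth_curve (act g \o gamma).
Proof. by move=> sg f; exact: (sg (Cinf_act g f)). Qed.

Lemma push_velocity g gamma : push g (velocity gamma) = velocity (act g \o gamma).
Proof. by []. Qed.

Definition transl g X (trX : \tr X = 0) (t : R) : SL4 R := SL4mul g (SLcurve trX t).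

Lemma transl0 g X (trX : \tr X = 0) : transl g trX 0 = g.
Proof. by apply: SL4_inj; rewrite /= LDU0 mulmx1. Qed.

Lemma is_derive_transl g X (trX : \tr X = 0) :
  is_derive (0 : R) 1 (fun t => SL4val (transl g trX t)) (g *m X).
Proof.
have H := is_derive_mulmx (is_derive_cst (SL4val g) (0 : R) 1) (is_derive_LDU X).
by apply: (is_derive_eq H); rewrite mul0mx add0r.
Qed.

Lemma smooth_transl g X (trX : \tr X = 0) : smooth_curve_SL4 (transl g trX).
Proof.
move=> k; apply: Ck_on_mulmx; [exact: openT|exact: Ck_on_cst|exact: smooth_LDU].
Qed.

Lemma is_lift_proj (c : R -> SL4 R) : is_lift (@proj R \o c) (fun t => SL4val (c t)).
Proof. by near=> t; exists (c t). Unshelve. all: by end_near. Qed.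

Lemma velocity_transl g X (trX : \tr X = 0) :
  velocity (@proj R \o transl g trX) = dpr g (g *m X).
Proof.
apply: (velocity_lift _ (is_lift_proj _) (is_derive_transl g trX)).
by rewrite transl0.
Qed.

(** Trace zero makes [g *m X] the velocity of a curve in SL(4), on which all extensions agree. Thus
    one extension can serve at all points of a neighbourhood. *)
Lemma dpr_ext f (U : set 'M[R]_4) F g X : is_ext f U F -> U g -> \tr X = 0 ->
  dpr g (g *m X) f = 'D_(g *m X) F g.
Proof.
move=> UF Ug trX; rewrite -(velocity_transl _ trX).
rewrite (velocity_ext UF _ (is_lift_proj _) (is_derive_transl g trX)) ?transl0//.
Qed.

Lemma tangent_dpr g X : \tr X = 0 -> tangent (proj g) (dpr g (g *m X)).
Proof.
move=> trX; exists (@proj R \o transl g trX); split.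
- exact/smooth_curve_proj/smooth_transl.
- by rewrite /= transl0.
- by rewrite velocity_transl.
Qed.

Lemma push_dpr h g X : \tr X = 0 ->
  push h (dpr g (g *m X)) = dpr (SL4mul h g) (SL4mul h g *m X).
Proof.
move=> trX; rewrite -!(velocity_transl _ trX) push_velocity; congr velocity.
apply/funext => t; rewrite /= act_proj; congr proj.
by apply: SL4_inj; rewrite /= mulmxA.
Qed.

Lemma mul_SL2block (B B' : 'M[R]_2) :
  ((block_mx 1%:M 0 0 B : 'M[R]_(2 + 2)) : 'M[R]_4) *m
  ((block_mx 1%:M 0 0 B' : 'M[R]_(2 + 2)) : 'M[R]_4) =
  (block_mx 1%:M 0 0 (B *m B') : 'M[R]_(2 + 2)).
Proof.
have := @mulmx_block R 2 2 2 2 2 2 1%:M 0 0 B 1%:M 0 0 B'.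
by rewrite !mul1mx !mul0mx !mulmx0 !add0r addr0.
Qed.

Lemma projM g h : SL2block R h -> proj (SL4mul g h) = proj g.
Proof.
move=> Lh; apply: eq_exist; apply/seteqP; split => _ [l Ll <-].
  case: Lh Ll => B detB hB [B' detB' lB'].
  exists (SL4mul h l); last by apply: SL4_inj; rewrite /= mulmxA.
  exists (B *m B'); first by rewrite det_mulmx detB detB' mulr1.
  by rewrite /= hB lB' mul_SL2block.
case: Lh Ll => B detB hB [B' detB' lB'].
have uB : B \in unitmx by rewrite unitmxE detB unitr1.
exists (SL4mul (SL4inv h) l); last first.
  by apply: SL4_inj; rewrite /= !mulmxA -(mulmxA _ h) SL4_mulmxV mulmx1.
exists (invmx B *m B'); first by rewrite det_mulmx detB' det_inv detB invr1 mulr1.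
have -> : SL4val (SL4mul (SL4inv h) l) = \adj h *m l by [].
symmetry; apply: SL4_mulmxI; rewrite hB lB'.
by rewrite mul_SL2block mulmxA mulmxV ?mul1mx.
Qed.

(** Multiplying a curve through [g h] on the right by [h^-1] does not change its projection, and
    moves it to a curve through [g]. Hence Ad(h) appears. *)
Lemma dpr_coset g h X : SL2block R h -> \tr X = 0 ->
  dpr (SL4mul g h) (SL4mul g h *m X) = dpr g (g *m (h *m X *m \adj h)).
Proof.
move=> Lh trX; rewrite -(velocity_transl _ trX).
apply: (velocity_lift (c := fun t => transl (SL4mul g h) trX t *m \adj h)).
- by rewrite transl0 /= -mulmxA SL4_mulmxV mulmx1.
- near=> t; exists (SL4mul (transl (SL4mul g h) trX t) (SL4inv h)) => //.
  rewrite /= -(projM (SL4mul _ (SL4inv h)) Lh); congr proj.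
  by apply: SL4_inj; rewrite /= -[RHS]mulmxA SL4_mulVmx mulmx1.
- have H := is_derive_mulmx (is_derive_transl (SL4mul g h) trX)
     (is_derive_cst (\adj h) (0 : R) 1).
  by apply: (is_derive_eq H); rewrite mulmx0 addr0 /= !mulmxA.
Unshelve. all: by end_near. Qed.

End Velocity.

(** * The SL(2)-module m *)

Section LinearAlgebra.
Variable R : realType.
Implicit Types (a b : EH R) (X Z : 'M[R]_4).

Definition mx4 (l : seq (seq R)) : 'M[R]_4 := \matrix_(i, j) nth 0 (nth [::] l i) j.

Definition row12 (l : seq R) : EH R := \row_k nth 0 l k.

(** Natural number indices let the entries of explicitly listed matrices reduce by computation. *)
Definition entry Z (i j : nat) : R := Z (inord i) (inord j).

(* The map alpha_[EH], extended to all matrices by ignoring the lower right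
   block; it thus kills l. *)
Definition alpha_seq (z : nat -> nat -> R) : seq R :=
  let p11 := z 0 2 in let p12 := z 0 3 in let p21 := z 1 2 in let p22 := z 1 3 in
  let q11 := z 2 0 in let q12 := z 2 1 in let q21 := z 3 0 in let q22 := z 3 1 in
  [:: - 2^-1 * p21 - 2^-1 * (p11 + p22) - p12;
            2^-1 * (q11 - q22) + q12;
            z 0 0;
            - 2^-1 * (q11 + q22);
            2^-1 * p21 + 2^-1 * (p11 + p22);
            z 1 0;
            2^-1 * (p11 - p22);
            2^-1 * (q22 - q11) + 2^-1 * q21;
            z 0 1;
            2^-1 * (q11 - q22) + q12 - 2^-1 * q21;
            2^-1 * (p11 + p22) + p12;
            z 1 1].

Definition alpha Z : EH R := row12 (alpha_seq (entry Z)).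

Lemma eq_EH a b :
  (forall k, (k < 12)%N -> a 0 (inord k) = b 0 (inord k)) -> a = b.
Proof.
by move=> ab; apply/rowP => i; have := ab i (ltn_ord i); rewrite inord_val.
Qed.

Lemma entry_val Z i j : Z i j = entry Z i j.
Proof. by rewrite /entry !inord_val. Qed.

Lemma mx4E l i j : (i < 4)%N -> (j < 4)%N ->
  entry (mx4 l) i j = nth 0 (nth [::] l i) j.
Proof. by move=> i4 j4; rewrite /entry mxE !inordK. Qed.

Lemma row12E l k : (k < 12)%N -> row12 l 0 (inord k) = nth 0 l k.
Proof. by move=> k12; rewrite mxE inordK. Qed.

(* [A k] stands for a_(k+1). *)
Definition alpha_inv_coef (A : nat -> R) (i j : nat) : R :=
  nth 0 (nth [::] [::
    [:: A 2; A 8; A 0 + A 4 + A 6 + A 10; - A 0 - A 4];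
    [:: A 5; A 11; - 2 * A 0 - 2 * A 10; A 0 + A 4 - A 6 + A 10];
    [:: A 1 - A 3 - A 7 - A 9; A 7 + A 9; - 2^-1 * A 2 - 2^-1 * A 11; 0];
    [:: 2 * A 1 - 2 * A 9; - A 1 - A 3 + A 7 + A 9; 0;
        - 2^-1 * A 2 - 2^-1 * A 11]] i) j.

Definition coord a (k : nat) : R := a 0 (inord k).
Arguments coord a k%_N.

Lemma alpha_inv_entry a (i j : nat) : (i < 4)%N -> (j < 4)%N ->
  entry (alpha_inv a) i j = alpha_inv_coef (coord a) i j.
Proof. by move=> i4 j4; rewrite /entry mxE !inordK. Qed.

Lemma alphaK a : alpha (alpha_inv a) = a.
Proof.
apply: eq_EH => k k12; rewrite row12E// /alpha_seq !alpha_inv_entry//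
  /alpha_inv_coef -/(coord a k) /=.
by do 12 (case: k k12 => [_|k k12]; first by rewrite /=; field).
Qed.

Lemma trace_alpha_inv a : \tr (alpha_inv a) = 0.
Proof.
rewrite /mxtrace !big_ord_recl big_ord0 !mxE /=. by field.
Qed.

Lemma alphaP (t : R) X Z : alpha (t *: X + Z) = t *: alpha X + alpha Z.
Proof.
apply: eq_EH => k k12; rewrite [RHS]mxE [X in _ = X + _]mxE !row12E//.
by do 12 (case: k k12 => [_|k k12]; first by rewrite /alpha_seq /entry /= !mxE; ring).
Qed.

Lemma alpha_invP (t : R) a b :
  alpha_inv (t *: a + b) = t *: alpha_inv a + alpha_inv b.
Proof.
apply/matrixP => i j; rewrite !mxE.
case: i => [[|[|[|[|//]]]] ?]; case: j => [[|[|[|[|//]]]] ?] /=; ring.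
Qed.

(** * Conjugation of m by SL(2) *)

Definition sl2mx (p q r s : R) : 'M[R]_4 :=
  mx4 [:: [:: 1; 0; 0; 0]; [:: 0; 1; 0; 0]; [:: 0; 0; p; q]; [:: 0; 0; r; s]].

Lemma mx4M (l l' : seq (seq R)) :
  mx4 l *m mx4 l' = \matrix_(i, j)
    (nth 0 (nth [::] l i) 0 * nth 0 (nth [::] l' 0) j +
     nth 0 (nth [::] l i) 1 * nth 0 (nth [::] l' 1) j +
     nth 0 (nth [::] l i) 2 * nth 0 (nth [::] l' 2) j +
     nth 0 (nth [::] l i) 3 * nth 0 (nth [::] l' 3) j).
Proof.
apply/matrixP => i j; rewrite !mxE !big_ord_recr big_ord0 /= !mxE /=.
by rewrite add0r.
Qed.

Lemma sl2mxM p q r s : p * s - q * r = 1 ->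
  sl2mx p q r s *m sl2mx s (- q) (- r) p = 1%:M.
Proof.
move=> det1; rewrite mx4M; apply/matrixP => i j; rewrite !mxE.
by case: i => [[|[|[|[|//]]]] ?]; case: j => [[|[|[|[|//]]]] ?] /=;
  first [ring | transitivity (p * s - q * r); [ring | rewrite det1; ring]].
Qed.

(** This is Ad(h) read on [EH], the last factor being the inverse of [sl2mx p q r s] when the
    determinant is 1. *)
Definition conj_alpha p q r s a : EH R :=
  alpha (sl2mx p q r s *m alpha_inv a *m sl2mx s (- q) (- r) p).

(* The lower right entries of [z] are ignored. *)
Definition m_mx (z : nat -> nat -> R) : 'M[R]_4 :=
  let d := - 2^-1 * (z 0 0 + z 1 1) in
  mx4 [:: [:: z 0 0; z 0 1; z 0 2; z 0 3];
          [:: z 1 0; z 1 1; z 1 2; z 1 3];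
          [:: z 2 0; z 2 1; d; 0];
          [:: z 3 0; z 3 1; 0; d]].

(** The last two rows stop after two entries because [m_mx] rebuilds the lower right block from the
    upper left one. *)
Definition conj_entry p q r s (z : nat -> nat -> R) (i j : nat) : R :=
  nth 0 (nth [::]
    [:: [:: z 0 0; z 0 1; z 0 2 * s - z 0 3 * r; z 0 3 * p - z 0 2 * q];
        [:: z 1 0; z 1 1; z 1 2 * s - z 1 3 * r; z 1 3 * p - z 1 2 * q];
        [:: p * z 2 0 + q * z 3 0; p * z 2 1 + q * z 3 1];
        [:: r * z 2 0 + s * z 3 0; r * z 2 1 + s * z 3 1]] i) j.

(** This shows that m is Ad(SL(2))-invariant: the upper left block is fixed, the lower right one is
    scalar and commutes with h, and the off-diagonal blocks are multiplied by h on the left or by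
    its inverse on the right. *)
Lemma conj_m_mx p q r s z : p * s - q * r = 1 ->
  sl2mx p q r s *m m_mx z *m sl2mx s (- q) (- r) p = m_mx (conj_entry p q r s z).
Proof.
move=> det1; rewrite mx4M /m_mx.
set d := _ * _; rewrite [in RHS]/conj_entry /= -/d.
apply/matrixP => i j; rewrite !mxE !big_ord_recr big_ord0 /= !mxE /=.
case: i => [[|[|[|[|//]]]] ?]; case: j => [[|[|[|[|//]]]] ?] /=; try ring.
  (* The two remaining diagonal entries are [d * (p * s - q * r)]. *)
  by rewrite -[RHS]mulr1 -det1; ring.
by rewrite -[RHS]mulr1 -det1; ring.
Qed.

(** On trace zero matrices this composite is the projection onto m along l. *)
Lemma alpha_invK Z : alpha_inv (alpha Z) = m_mx (entry Z).
Proof.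
rewrite /m_mx; apply/matrixP => i j; rewrite entry_val [RHS]entry_val.
rewrite alpha_inv_entry// mx4E// /alpha_inv_coef /coord /= !row12E//= /alpha_seq.
by case: i => [[|[|[|[|//]]]] ?]; case: j => [[|[|[|[|//]]]] ?] /=; field.
Qed.

Lemma alpha_inv_m_mx a : alpha_inv a = m_mx (entry (alpha_inv a)).
Proof. by rewrite -alpha_invK alphaK. Qed.

Lemma m_mx_entry z : m_mx (entry (m_mx z)) = m_mx z.
Proof. by rewrite /m_mx !mx4E. Qed.

Lemma alpha_inv_conj p q r s a : p * s - q * r = 1 ->
  alpha_inv (conj_alpha p q r s a) =
  sl2mx p q r s *m alpha_inv a *m sl2mx s (- q) (- r) p.
Proof.
by move=> det1; rewrite /conj_alpha (alpha_inv_m_mx a) conj_m_mx// alpha_invK m_mx_entry.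
Qed.

(** * Coordinate formulas for the standard structure and for Ad(SL(2)) on [EH] *)

Lemma EHvec_entry (x y z w : 'rV[R]_3) k : (k < 12)%N ->
  EHvec x y z w 0 (inord k) =
  nth 0 [:: x 0 (inord 0); x 0 (inord 1); x 0 (inord 2);
            y 0 (inord 0); y 0 (inord 1); y 0 (inord 2);
            z 0 (inord 0); z 0 (inord 1); z 0 (inord 2);
            w 0 (inord 0); w 0 (inord 1); w 0 (inord 2)] k.
Proof.
have E1 c : (c < 3)%N ->
    inord c = lshift (3 + 3) (lshift 3 (inord c : 'I_3)) :> 'I_(3 + 3 + (3 + 3)).
  by case: c => [|[|[|]]]// _; apply: val_inj; rewrite /= !inordK.
have E2 c : (c < 3)%N ->
    inord (3 + c) = lshift (3 + 3) (rshift 3 (inord c : 'I_3)) :> 'I_(3 + 3 + (3 + 3)).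
  by case: c => [|[|[|]]]// _; apply: val_inj; rewrite /= !inordK.
have E3 c : (c < 3)%N ->
    inord (6 + c) = rshift (3 + 3) (lshift 3 (inord c : 'I_3)) :> 'I_(3 + 3 + (3 + 3)).
  by case: c => [|[|[|]]]// _; apply: val_inj; rewrite /= !inordK.
have E4 c : (c < 3)%N ->
    inord (9 + c) = rshift (3 + 3) (rshift 3 (inord c : 'I_3)) :> 'I_(3 + 3 + (3 + 3)).
  by case: c => [|[|[|]]]// _; apply: val_inj; rewrite /= !inordK.
rewrite /EHvec.
case: k => [_|]; first by rewrite (E1 0)// !row_mxEl.
case => [_|]; first by rewrite (E1 1)// !row_mxEl.
case => [_|]; first by rewrite (E1 2)// !row_mxEl.
case => [_|]; first by rewrite (E2 0)// row_mxEl row_mxEr.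
case => [_|]; first by rewrite (E2 1)// row_mxEl row_mxEr.
case => [_|]; first by rewrite (E2 2)// row_mxEl row_mxEr.
case => [_|]; first by rewrite (E3 0)// row_mxEr row_mxEl.
case => [_|]; first by rewrite (E3 1)// row_mxEr row_mxEl.
case => [_|]; first by rewrite (E3 2)// row_mxEr row_mxEl.
case => [_|]; first by rewrite (E4 0)// !row_mxEr.
case => [_|]; first by rewrite (E4 1)// !row_mxEr.
case => [_|//]; by rewrite (E4 2)// !row_mxEr.
Qed.

Lemma oppmx_entry m n (A : 'M[R]_(m, n)) i j : (- A) i j = - A i j.
Proof. by rewrite mxE. Qed.

Lemma block_entries a (c : nat) : (c < 3)%N ->
  [/\ lsubmx (lsubmx a) 0 (inord c) = coord a c,
      rsubmx (lsubmx a) 0 (inord c) = coord a (3 + c),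
      lsubmx (rsubmx a) 0 (inord c) = coord a (6 + c)
    & rsubmx (rsubmx a) 0 (inord c) = coord a (9 + c)].
Proof.
by case: c => [|[|[|]]]// _; rewrite !mxE /coord; split; congr (a _ _);
  apply: val_inj; rewrite /= !inordK.
Qed.

Lemma row12_blocks (x y z w : 'rV[R]_3) (X Y Z W : nat -> R) :
  (forall c, (c < 3)%N -> [/\ x 0 (inord c) = X c, y 0 (inord c) = Y c,
     z 0 (inord c) = Z c & w 0 (inord c) = W c]) ->
  EHvec x y z w = row12 [:: X 0; X 1; X 2; Y 0; Y 1; Y 2; Z 0; Z 1; Z 2; W 0; W 1; W 2].
Proof.
move=> H; apply: eq_EH => k k12; rewrite row12E// EHvec_entry//.
by have [[-> -> -> ->] [-> -> -> ->] [-> -> -> ->]] :=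
  And3 (H 0 erefl) (H 1 erefl) (H 2 erefl).
Qed.

Lemma J1stdE a : J1std a = let A := coord a in
  row12 [:: - A 3; - A 4; - A 5; A 0; A 1; A 2; - A 9; - A 10; - A 11; A 6; A 7; A 8].
Proof.
apply: (row12_blocks (X := fun c => - coord a (3 + c)) (Y := coord a)
  (Z := fun c => - coord a (9 + c)) (W := fun c => coord a (6 + c))) => c c3.
by rewrite !oppmx_entry; have [-> -> -> ->] := block_entries a c3.
Qed.

Lemma J2stdE a : J2std a = let A := coord a in
  row12 [:: - A 6; - A 7; - A 8; A 9; A 10; A 11; A 0; A 1; A 2; - A 3; - A 4; - A 5].
Proof.
apply: (row12_blocks (X := fun c => - coord a (6 + c)) (Y := fun c => coord a (9 + c))
  (Z := coord a) (W := fun c => - coord a (3 + c))) => c c3.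
by rewrite !oppmx_entry; have [-> -> -> ->] := block_entries a c3.
Qed.

Lemma J3stdE a : J3std a = let A := coord a in
  row12 [:: - A 9; - A 10; - A 11; - A 6; - A 7; - A 8; A 3; A 4; A 5; A 0; A 1; A 2].
Proof.
apply: (row12_blocks (X := fun c => - coord a (9 + c)) (Y := fun c => - coord a (6 + c))
  (Z := fun c => coord a (3 + c)) (W := coord a)) => c c3.
by rewrite !oppmx_entry; have [-> -> -> ->] := block_entries a c3.
Qed.

Lemma omega_stdE a b : omega_std a b =
  \sum_(k < 6) (coord a k * coord b (6 + k) - coord a (6 + k) * coord b k).
Proof.
apply: eq_bigr => k _; rewrite !mxE /coord.
have -> : lshift (3 + 3) k = inord k.
  by apply: val_inj; rewrite /= inordK// (leq_trans (ltn_ord k)).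
have -> : rshift (3 + 3) k = inord (6 + k).
  by apply: val_inj; rewrite /= inordK// ltn_add2l ltn_ord.
by [].
Qed.

Lemma coord_row12 l k : (k < 12)%N -> coord (row12 l) k = nth 0 l k.
Proof. exact: row12E. Qed.

(** With indices from 0, the coordinates c, c+3, c+6, c+9 form one quaternionic line; the line c = 2
    is fixed. On the other two, the operators multiplying [t], [u], [v], [w] are the identity and
    three anticommuting ones with squares 1, -1, 1. They span the split quaternions, a copy of the
    algebra of 2 x 2 matrices, with norm t^2 - u^2 + v^2 - w^2. *)
Definition twist (t u v w : R) a : EH R :=
  let a0 := coord a 0 in let a1 := coord a 1 in let a3 := coord a 3 in
  let a4 := coord a 4 in let a6 := coord a 6 in let a7 := coord a 7 in
  let a9 := coord a 9 in let a10 := coord a 10 in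
  row12 [:: t * a0 + u * a4 + v * a6 - w * a10;
            t * a1 - u * a3 + v * a7 + w * a9;
            coord a 2;
            - u * a1 + t * a3 + w * a7 + v * a9;
            u * a0 + t * a4 - w * a6 + v * a10;
            coord a 5;
            - v * a0 - w * a4 + t * a6 - u * a10;
            - v * a1 + w * a3 + t * a7 + u * a9;
            coord a 8;
            w * a1 - v * a3 + u * a7 + t * a9;
            - w * a0 - v * a4 - u * a6 + t * a10;
            coord a 11].

Lemma conj_alphaE p q r s a : p * s - q * r = 1 ->
  conj_alpha p q r s a =
  (* These are the split quaternion coefficients of the 2 x 2 block; the first is half its trace,
     and their norm is its determinant. *)
  twist (2^-1 * (p + s)) (2^-1 * (p - s) + q) (2^-1 * (p - r - s) + q)
        (2^-1 * (p - r - s)) a.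
Proof.
move=> det1; rewrite /conj_alpha {1}(alpha_inv_m_mx a) conj_m_mx//.
rewrite /alpha /alpha_seq !mx4E//= /conj_entry/= !alpha_inv_entry// /alpha_inv_coef /twist /=.
by congr (row12 [:: _; _; _; _; _; _; _; _; _; _; _; _]); field.
Qed.

Lemma J1std_twist t u v w a : J1std (twist t u v w a) = twist t u v w (J1std a).
Proof.
rewrite [LHS]J1stdE /= !coord_row12//= J1stdE /twist !coord_row12//=.
by congr (row12 [:: _; _; _; _; _; _; _; _; _; _; _; _]); ring.
Qed.

Lemma J2std_twist t u v w a : J2std (twist t u v w a) = twist t u v w (J2std a).
Proof.
rewrite [LHS]J2stdE /= !coord_row12//= J2stdE /twist !coord_row12//=.
by congr (row12 [:: _; _; _; _; _; _; _; _; _; _; _; _]); ring.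
Qed.

Lemma J3std_twist t u v w a : J3std (twist t u v w a) = twist t u v w (J3std a).
Proof.
rewrite [LHS]J3stdE /= !coord_row12//= J3stdE /twist !coord_row12//=.
by congr (row12 [:: _; _; _; _; _; _; _; _; _; _; _; _]); ring.
Qed.

(** A twist multiplies the form on the first two quaternionic lines by its norm and leaves the third
    alone; the last factor is the part of [omega_std] on those two lines. *)
Lemma omega_std_twist t u v w a b :
  omega_std (twist t u v w a) (twist t u v w b) - omega_std a b =
  (t ^+ 2 - u ^+ 2 + v ^+ 2 - w ^+ 2 - 1) *
  (omega_std a b - (coord a 2 * coord b 8 - coord a 8 * coord b 2) -
    (coord a 5 * coord b 11 - coord a 11 * coord b 5)).
Proof.
rewrite !omega_stdE !big_ord_recr !big_ord0 /= !coord_row12//=.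
ring.
Qed.

End LinearAlgebra.

(** * Invariants separating the points of the quotient *)

Lemma det_mx2 (R : comNzRingType) (A : 'M[R]_2) :
  \det A = A 0 0 * A 1 1 - A 0 1 * A 1 0.
Proof.
rewrite (expand_det_row _ 0) !big_ord_recl big_ord0 /cofactor !det_mx11 !mxE /=.
rewrite !addn0 expr0 mul1r expr1 mulN1r addr0 mulrN.
by congr (_ * A _ _ - A _ _ * A _ _); exact: val_inj.
Qed.

Section Invariants.
Variable R : realType.
Implicit Types (g h k : SL4 R) (X Y : 'M[R]_4) (f : Cinf R) (a : EH R).

HB.instance Definition _ := GRing.isLinear.Build R 'M[R]_4 (EH R) _ (@alpha R) (@alphaP R).

Definition E4 : 'M[R]_4 := diag_mx (\row_j (j < 2)%:R).

Lemma mulE4mx X i j : (E4 *m X) i j = (i < 2)%:R * X i j.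
Proof. by rewrite mul_diag_mx !mxE. Qed.

Lemma mulmxE4 X i j : (X *m E4) i j = X i j * (j < 2)%:R.
Proof. by rewrite mul_mx_diag !mxE. Qed.

Lemma E4_idem : E4 *m E4 = E4.
Proof.
by apply/matrixP => i j; rewrite mulE4mx !mxE; case: ltnP; rewrite ?mul1r// mul0r mul0rn.
Qed.

(** Together with trace zero this describes l. *)
Definition supp22 X := E4 *m X = 0 /\ X *m E4 = 0.

Lemma SL2blockE h : SL2block R h -> exists p q r s,
  [/\ p * s - q * r = 1, SL4val h = sl2mx p q r s & \adj h = sl2mx s (- q) (- r) p].
Proof.
move=> [B detB hB]; exists (B 0 0), (B 0 1), (B 1 0), (B 1 1).
have det1 : B 0 0 * B 1 1 - B 0 1 * B 1 0 = 1.
  by rewrite -det_mx2.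
have hE : SL4val h = sl2mx (B 0 0) (B 0 1) (B 1 0) (B 1 1).
  rewrite hB; apply/matrixP => i j.
  case: (@split_ordP 2 2 i) => {}i ->; case: (@split_ordP 2 2 j) => {}j ->;
    rewrite ?(@block_mxEul R 2 2 2 2, @block_mxEur R 2 2 2 2,
      @block_mxEdl R 2 2 2 2, @block_mxEdr R 2 2 2 2) !mxE /=;
    case: i => [[|[|//]] ?]; case: j => [[|[|//]] ?] //=;
    rewrite ?mulr1n//; try by congr (B _ _); exact: val_inj.
split=> //; have hV := sl2mxM det1.
by rewrite -hE in hV; have -> := SL4_mulmxI hV; rewrite mulmx1.
Qed.

Lemma SL2blockP h : E4 *m h = E4 -> h *m E4 = E4 -> SL2block R h.
Proof.
move=> Eh hE.
have rows (i j : 'I_4) : (i < 2)%N -> SL4val h i j = (i == j)%:R.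
  move=> i2; have /matrixP/(_ i j) := Eh; rewrite mulE4mx i2 mul1r => ->.
  by rewrite !mxE i2.
have cols (i j : 'I_4) : (j < 2)%N -> SL4val h i j = (i == j)%:R.
  move=> j2; have /matrixP/(_ i j) := hE; rewrite mulmxE4 j2 mulr1 => ->.
  by rewrite !mxE; case: eqP => [->|//]; rewrite j2.
have l2 (i : 'I_2) : (lshift 2 i < 2)%N := ltn_ord i.
pose B : 'M[R]_2 :=
  \matrix_(i, j) SL4val h (rshift 2 i : 'I_(2 + 2)) (rshift 2 j : 'I_(2 + 2)).
have hB : SL4val h = (block_mx 1%:M 0 0 B : 'M[R]_(2 + 2)).
  apply/matrixP => i j.
  case: (@split_ordP 2 2 i) => {}i ->; case: (@split_ordP 2 2 j) => {}j ->;
    rewrite ?(@block_mxEul R 2 2 2 2, @block_mxEur R 2 2 2 2,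
      @block_mxEdl R 2 2 2 2, @block_mxEdr R 2 2 2 2).
  - by rewrite (rows _ _ (l2 i)) mxE.
  - by rewrite (rows _ _ (l2 i)) mxE (@eq_lrshift 2 2).
  - by rewrite (cols _ _ (l2 j)) mxE (@eq_rlshift 2 2).
  - by rewrite mxE.
exists B => //; have := SL4P h; rewrite hB => <-.
by rewrite (@det_ublock R 2 2) det1 mul1r.
Qed.

Lemma SL2block_E4 h : SL2block R h -> E4 *m h = E4 /\ h *m E4 = E4.
Proof.
move=> /SL2blockE[p [q [r [s [_ -> _]]]]].
split; apply/matrixP => i j; rewrite ?mulE4mx ?mulmxE4 !mxE;
  case: i => [[|[|[|[|//]]]] ?]; case: j => [[|[|[|[|//]]]] ?];
  by rewrite /= ?(mul1r, mulr1, mul0r, mulr0).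
Qed.

Lemma SL2block_inv h : SL2block R h -> SL2block R (SL4inv h).
Proof.
move=> /SL2block_E4[Eh hE]; apply: SL2blockP => /=.
  by rewrite -{1}Eh -mulmxA SL4_mulmxV mulmx1.
by rewrite -{1}hE mulmxA SL4_mulVmx mul1mx.
Qed.

Lemma proj_eq g h : proj g = proj h -> exists2 l, SL2block R l & g = SL4mul h l.
Proof.
move=> /(congr1 sval) /= gh.
have [l Ll lg] : lcoset h g.
  rewrite -gh; exists (SL4one R).
    by exists 1%:M; rewrite ?det1// /= -scalar_mx_block.
  by apply: SL4_inj; rewrite /= mulmx1.
by exists l.
Qed.

(** The choice is arbitrary and carries no regularity; smoothness is proved only for expressions
    that do not depend on it. *)
Definition rep (p : homsp R) : SL4 R := sval (cid (svalP p)).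

Lemma repK p : proj (rep p) = p.
Proof. by rewrite /rep; case: cid => g /= pg; case: p pg => A Ag /= pg; exact: eq_exist. Qed.

Lemma rep_proj g : exists2 l, SL2block R l & rep (proj g) = SL4mul g l.
Proof. by apply: proj_eq; rewrite repK. Qed.

Lemma rep_projE4 g : rep (proj g) *m E4 = g *m E4.
Proof.
by have [l /SL2block_E4[_ lE] ->] := rep_proj g; rewrite /= -mulmxA lE.
Qed.

Lemma rep_projE4V g : E4 *m \adj (rep (proj g)) = E4 *m \adj g.
Proof.
have [l /SL2block_inv/SL2block_E4[/= El _] ->] := rep_proj g.
have -> : \adj (SL4mul g l) = \adj l *m \adj g.
  have := SL4_mulmxI (g := SL4mul g l) (A := \adj l *m \adj g) (B := 1%:M).
  rewrite mulmx1 => -> //=.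
  by rewrite mulmxA -(mulmxA g) SL4_mulmxV mulmx1 SL4_mulmxV.
by rewrite mulmxA El.
Qed.

Lemma smooth_ufun i j : smooth_fun (fun p => (rep p *m E4) i j).
Proof.
rewrite /smooth_fun (_ : _ \o _ = fun g => (g *m E4) i j).
  by apply: smooth_mx_mul; [exact: smooth_mx_val|exact: smooth_mx_cst].
by apply/funext => g /=; rewrite rep_projE4.
Qed.

Lemma smooth_vfun i j : smooth_fun (fun p => (E4 *m \adj (rep p)) i j).
Proof.
rewrite /smooth_fun (_ : _ \o _ = fun g => (E4 *m \adj g) i j).
  by apply: smooth_mx_mul; [exact: smooth_mx_cst|exact: smooth_mx_adj].
by apply/funext => g /=; rewrite rep_projE4V.
Qed.

Definition ufun i j : Cinf R := exist _ _ (smooth_ufun i j).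
Definition vfun i j : Cinf R := exist _ _ (smooth_vfun i j).

End Invariants.

(** * Frames and coordinates *)

Section Tangent.
Variable R : realType.
Implicit Types (g h k : SL4 R) (X Y : 'M[R]_4) (f : Cinf R) (a : EH R) (D : tvec R).

Definition Umat D : 'M[R]_4 := \matrix_(i, j) D (ufun R i j).
Definition Vmat D : 'M[R]_4 := \matrix_(i, j) D (vfun R i j).

(** For [D = dpr g (g *m X)] one has U = g X e and V = - e X g^-1. The argument of [alpha] is then X
    e + e X (1 - e), which agrees with X outside the lower right block that [alpha] ignores. *)
Definition coordg g D : EH R :=
  alpha (\adj g *m Umat D - Vmat D *m g *m (1%:M - E4 R)).

Definition iotag g a : tvec R := dpr g (g *m alpha_inv a).

(** The adjugate is polynomial, so the curve is derivable; its derivative then follows by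
    differentiating [\adj (c t) *m c t = 1]. *)
Lemma is_derive_adj (c : R -> SL4 R) Y : smooth_curve_SL4 c ->
  is_derive (0 : R) 1 (fun t => SL4val (c t)) Y ->
  is_derive (0 : R) 1 (fun t => \adj (c t)) (- (\adj (c 0) *m Y *m \adj (c 0))).
Proof.
move=> sc dc.
have dA : derivable (fun t => \adj (c t)) 0 1.
  apply/derivable_mxP => i j; apply/derivable1_diffP.
  have oT := @openT R; have oT' := @openT 'M[R]_4.
  have [dF _] : Ck_on 1 setT (fun t => \adj (c t) i j).
    exact: (Ck_on_comp oT' oT (fun _ _ => I) (Ck_on_adj 1 i j oT') (sc 1%N)).
  exact: dF.
split=> //.
have H := is_derive_mulmx (derivableP dA) dc.
have [_] := H.
have -> : (fun y => \adj (c y) *m c y) = cst (1%:M : 'M[R]_4).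
  by apply/funext => t; rewrite SL4_mulVmx.
rewrite derive_cst => /esym/eqP; rewrite addr_eq0 => /eqP e.
by rewrite -[LHS]mulmx1 -(SL4_mulmxV (c 0)) mulmxA e mulNmx.
Qed.

Lemma Umat_velocity gamma (c : R -> 'M[R]_4) Y : is_lift gamma c ->
  is_derive (0 : R) 1 c Y -> Umat (velocity gamma) = Y *m E4 R.
Proof.
move=> lc dc; apply/matrixP => i j; rewrite mxE /velocity derive1E.
have H := is_derive_mulmx dc (is_derive_cst (E4 R) (0 : R) 1).
transitivity ('D_1 (fun t => (c t *m E4 R) i j) 0).
  apply: near_eq_derive; near=> t.
  have [s sc gs] : exists2 s : SL4 R, SL4val s = c t & gamma t = proj s by near: t.
  by rewrite /= gs rep_projE4 sc.
by have /is_derive_mxP/(_ i j)[_ ->] := H; rewrite mulmx0 addr0.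
Unshelve. all: by end_near. Qed.

Lemma Vmat_velocity (c : R -> SL4 R) Y : smooth_curve_SL4 c ->
  is_derive (0 : R) 1 (fun t => SL4val (c t)) Y ->
  Vmat (velocity (@proj R \o c)) = - (E4 R *m \adj (c 0) *m Y *m \adj (c 0)).
Proof.
move=> sc dc; apply/matrixP => i j; rewrite mxE /velocity derive1E.
have H := is_derive_mulmx (is_derive_cst (E4 R) (0 : R) 1) (is_derive_adj sc dc).
transitivity ('D_1 (fun t => (E4 R *m \adj (c t)) i j) 0).
  by apply: near_eq_derive; near=> t; rewrite /= rep_projE4V.
by have /is_derive_mxP/(_ i j)[_ ->] := H; rewrite mul0mx add0r mulmxN !mulmxA.
Unshelve. all: by end_near. Qed.

Lemma eq_alpha X Y :
  (forall i j : 'I_4, (i < 2)%N || (j < 2)%N -> X i j = Y i j) -> alpha X = alpha Y.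
Proof.
move=> XY; have H (i j : nat) : (i < 4)%N -> (j < 4)%N -> (i < 2)%N || (j < 2)%N ->
    entry X i j = entry Y i j.
  by move=> i4 j4 ij; apply: XY; rewrite !inordK.
by rewrite /alpha /alpha_seq !H.
Qed.

Lemma coordg_dpr g X : \tr X = 0 -> coordg g (dpr g (g *m X)) = alpha X.
Proof.
move=> trX; rewrite /coordg -(velocity_transl g trX).
rewrite (Umat_velocity (is_lift_proj _) (is_derive_transl g trX)).
rewrite (Vmat_velocity (smooth_transl g trX) (is_derive_transl g trX)) transl0.
rewrite !mulNmx opprK -!mulmxA !(mulmxA (\adj g)) SL4_mulVmx !mul1mx.
apply: eq_alpha => i j ij.
rewrite mxE mulmxE4 mulmxBr mulmx1 mulmxBr mxE [X in _ + (_ + X)]mxE.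
rewrite mulmxA mulmxE4 !mulE4mx.
by move: ij; case: (i < 2)%N; case: (j < 2)%N => //= _; ring.
Qed.

Lemma coordg_iotag g a : coordg g (iotag g a) = a.
Proof. by rewrite coordg_dpr ?alphaK// trace_alpha_inv. Qed.

(** Both triangular parts of X are killed by e on either side, and the first two diagonal
    exponentials are exp 0 = 1. Hence, for X in l, the curve stays in SL(2) and its projection is
    constant. *)
Lemma E4_LDU X t : supp22 X -> E4 R *m LDU X t = E4 R /\ LDU X t *m E4 R = E4 R.
Proof.
move=> [EX XE].
have r0 (i j : 'I_4) : (i < 2)%N -> X i j = 0.
  by move=> i2; have /matrixP/(_ i j) := EX; rewrite mulE4mx i2 mul1r mxE.
have c0 (i j : 'I_4) : (j < 2)%N -> X i j = 0.
  by move=> j2; have /matrixP/(_ i j) := XE; rewrite mulmxE4 j2 mulr1 mxE.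
have El : E4 R *m lower X = 0.
  by apply/matrixP => i j; rewrite mulE4mx !mxE; case: (ltnP i 2) => i2;
     rewrite ?mul0r// mul1r; case: ifP => // _; exact: r0.
have lE : lower X *m E4 R = 0.
  by apply/matrixP => i j; rewrite mulmxE4 !mxE; case: (ltnP j 2) => j2;
     rewrite ?mulr0// mulr1; case: ifP => // _; exact: c0.
have Elt : E4 R *m (lower X^T)^T = 0.
  by apply/matrixP => i j; rewrite mulE4mx !mxE; case: (ltnP i 2) => i2;
     rewrite ?mul0r// mul1r; case: ifP => // _; exact: r0.
have ltE : (lower X^T)^T *m E4 R = 0.
  by apply/matrixP => i j; rewrite mulmxE4 !mxE; case: (ltnP j 2) => j2;
     rewrite ?mulr0// mulr1; case: ifP => // _; exact: c0.
have Ed : E4 R *m diag_mx (dexp X t) = E4 R.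
  apply/matrixP => i j; rewrite mulE4mx !mxE; case: (ltnP i 2) => i2.
    by rewrite r0// mulr0 expR0 mul1r.
  by rewrite mul0r mul0rn.
have dE : diag_mx (dexp X t) *m E4 R = E4 R.
  apply/matrixP => i j; rewrite mulmxE4 !mxE; case: (ltnP j 2) => j2.
    by case: eqP => [->|_]; rewrite ?mulr0n ?mul0r// !j2 r0// mulr0 expR0 mulr1.
  by case: eqP => [->|_]; rewrite ?mulr0n ?mul0r ?mulr0// ltnNge j2.
rewrite /LDU linearD linearZ/= trmx1; split.
  rewrite !mulmxA; have -> : E4 R *m (1%:M + t *: lower X) = E4 R.
    by rewrite mulmxDr mulmx1 -scalemxAr El scaler0 addr0.
  by rewrite Ed mulmxDr mulmx1 -scalemxAr Elt scaler0 addr0.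
rewrite -!mulmxA; have -> : (1%:M + t *: (lower X^T)^T) *m E4 R = E4 R.
  by rewrite mulmxDl mul1mx -scalemxAl ltE scaler0 addr0.
by rewrite dE mulmxDl mul1mx -scalemxAl lE scaler0 addr0.
Qed.

Lemma dpr_supp22 g X : supp22 X -> \tr X = 0 -> dpr g (g *m X) = fun=> 0.
Proof.
move=> sX trX; rewrite -(velocity_transl g trX); apply/funext => f.
have -> : velocity (@proj R \o transl g trX) f = derive1 (cst (sval f (proj g)) : R -> R) 0.
  congr (derive1 _ 0); apply/funext => t /=; congr (sval f _); apply: projM.
  by have [? ?] := E4_LDU t sX; apply: SL2blockP.
by rewrite derive1_cst.
Qed.

End Tangent.

(** * Tangent vectors of the quotient *)

Section TangentRange.
Variable R : realType.
Implicit Types (g h k : SL4 R) (X Y : 'M[R]_4) (f : Cinf R) (a : EH R) (D : tvec R).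

Local Notation E := (E4 R).

(** The difference of [Y] and its component in m lies in l, which the differential kills. *)
Lemma dpr_alpha g Y : \tr Y = 0 -> dpr g (g *m Y) = iotag g (alpha Y).
Proof.
move=> trY; pose L := Y - alpha_inv (alpha Y).
have LE (i j : 'I_4) : (i < 2)%N || (j < 2)%N -> L i j = 0.
  rewrite /L alpha_invK mxE [X in _ + X]mxE (entry_val (m_mx _)) mx4E// (entry_val Y).
  case: i => [[|[|[|[|//]]]] ?]; case: j => [[|[|[|[|//]]]] ?] //= _; exact: subrr.
have sL : supp22 L.
  split; apply/matrixP => i j; rewrite ?mulE4mx ?mulmxE4 [RHS]mxE.
    by case: (ltnP i 2) => i2; rewrite ?mul0r// LE ?i2// mulr0.
  by case: (ltnP j 2) => j2; rewrite ?mulr0// LE ?j2 ?orbT// mul0r.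
have trL : \tr L = 0 by rewrite /L linearB/= trY trace_alpha_inv subr0.
apply/funext => f; rewrite /iotag -[Y in LHS](subrK (alpha_inv (alpha Y))) -/L mulmxDr.
rewrite -[g *m L]scale1r dprP.
by have := dpr_supp22 g sL trL => /(congr1 (fun D => D f)) ->; rewrite mulr0 add0r.
Qed.

(* [A + (1 - A B)(1 - e)] factors as [(A + (1 - e)) (1 - B (1 - e))], a block
   triangular times a unipotent matrix. *)
Lemma det_section (A B : 'M[R]_4) : A *m E = A -> E *m B = B ->
  \det (A + (1%:M - A *m B) *m (1%:M - E)) = A 0 0 * A 1 1 - A 0 1 * A 1 0.
Proof.
move=> AE EB.
have -> : A + (1%:M - A *m B) *m (1%:M - E) =
    (A + (1%:M - E)) *m (1%:M - B *m (1%:M - E)).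
  have QB : (1%:M - E) *m B = 0 by rewrite mulmxBl mul1mx EB subrr.
  set Q := 1%:M - E in QB *; rewrite mulmxBl mul1mx [RHS]mulmxDl !mulmxBr !mulmx1.
  rewrite (mulmxA Q B) QB mul0mx subr0 mulmxA.
  by rewrite subr0 addrA addrAC.
rewrite det_mulmx.
have -> : \det (1%:M - B *m (1%:M - E)) = 1.
  (* Since e B = B, the matrix B (1 - e) lives in the upper right block; the transpose below brings
     the unipotent factor into the lower triangular form of [det_trig]. *)
  have BE i j : (B *m (1%:M - E)) i j = (i < 2)%:R * B i j * (1 - (j < 2)%:R).
    rewrite mulmxBr mulmx1 mxE [X in _ + X]mxE mulmxE4.
    by rewrite -[_ * B i j]mulE4mx EB; ring.
  rewrite -det_tr det_trig.
    apply: big1 => i _; rewrite mxE mxE [X in _ + X]mxE BE.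
    by case: (i < 2)%N; rewrite /= ?subrr ?mulr0 ?mul0r subr0 mxE eqxx.
  apply/is_trig_mxP => i j ij; rewrite mxE mxE [X in _ + X]mxE BE mxE.
  have -> : (j == i) = false by apply/negbTE; rewrite -val_eqE neq_ltn ij orbT.
  case: (ltnP j 2) => j2; last by rewrite /= !mul0r subr0.
  by rewrite (ltn_trans ij j2) subrr mulr0 subr0.
rewrite mulr1.
pose ul : 'M[R]_2 := \matrix_(i, j) A (lshift 2 i : 'I_(2 + 2)) (lshift 2 j : 'I_(2 + 2)).
pose dl : 'M[R]_2 := \matrix_(i, j) A (rshift 2 i : 'I_(2 + 2)) (lshift 2 j : 'I_(2 + 2)).
have -> : A + (1%:M - E) = (block_mx ul 0 dl 1%:M : 'M[R]_(2 + 2)).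
  apply/matrixP => i j; rewrite mxE mxE [X in _ + (_ + X)]mxE -AE mulmxE4.
  have -> : E i j = (i == j)%:R * (j < 2)%:R.
    by rewrite !mxE; case: eqP => [->|_]; rewrite ?mul1r ?mulr1n ?mulr0n ?mul0r.
  rewrite mxE.
  case: (@split_ordP 2 2 i) => {}i ->; case: (@split_ordP 2 2 j) => {}j ->;
    rewrite ?(@block_mxEul R 2 2 2 2, @block_mxEur R 2 2 2 2,
      @block_mxEdl R 2 2 2 2, @block_mxEdr R 2 2 2 2) !mxE /=.
  - by ring.
  - by rewrite (@eq_lrshift 2 2) /=; ring.
  - by ring.
  - by rewrite (@eq_rshift 2 2) /=; ring.
rewrite (@det_lblock R 2 2) det1 mulr1 det_mx2 !mxE.
by congr (A _ _ * A _ _ - A _ _ * A _ _); exact: val_inj.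
Qed.

Lemma is_derive_uniq (V W : normedModType R) (F : V -> W) x v A B :
  is_derive x v F A -> is_derive x v F B -> A = B.
Proof. by move=> [_ <-] [_ <-]. Qed.

Lemma velocity_origin gamma : smooth_curve gamma -> gamma 0 = proj (SL4one R) ->
  exists2 Y, \tr Y = 0 & velocity gamma = dpr (SL4one R) Y.
Proof.
move=> sg g0.
(* The entries of these curves are [ufun] and [vfun] along [gamma], so they are smooth although
   [rep] is not. *)
pose A t := rep (gamma t) *m E; pose B t := E *m \adj (rep (gamma t)).
have dA : derivable A 0 1.
  apply/derivable_mxP => i j; apply/derivable1_diffP.
  by have [dF _] := sg (ufun R i j) 1%N; exact: dF.
have dB : derivable B 0 1.
  apply/derivable_mxP => i j; apply/derivable1_diffP.
  by have [dF _] := sg (vfun R i j) 1%N; exact: dF.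
have A0 : A 0 = E by rewrite /A g0 rep_projE4 /= mul1mx.
have B0 : B 0 = E.
  by rewrite /B g0 rep_projE4V /= adj1 mulmx1.
have AE t : A t *m E = A t by rewrite /A -mulmxA E4_idem.
have EB t : E *m B t = B t by rewrite /B mulmxA E4_idem.
have BA t : B t *m A t = E.
  by rewrite /A /B -mulmxA (mulmxA (\adj _)) SL4_mulVmx mul1mx E4_idem.
have iA := derivableP dA; have iB := derivableP dB.
set A' := 'D_1 A 0 in iA; set B' := 'D_1 B 0 in iB.
have iE := is_derive_cst E (0 : R) 1.
have iE1 := is_derive_cst (1%:M - E) (0 : R) 1.
have A'E : A' *m E = A'.
  have H := is_derive_mulmx iA iE; rewrite mulmx0 addr0 in H.
  by apply: is_derive_uniq H _; rewrite (_ : (fun t => _) = A)//; apply/funext.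
have EB' : E *m B' = B'.
  have H := is_derive_mulmx iE iB; rewrite mul0mx add0r in H.
  by apply: is_derive_uniq H _; rewrite (_ : (fun t => _) = B)//; apply/funext.
(* By [det_section] this minor is the determinant of the section [c0] below. *)
pose d t := A t 0 0 * A t 1 1 - A t 0 1 * A t 1 0.
have d0 : d 0 = 1.
  by rewrite /d A0 !mxE /=; ring.
have id' : is_derive (0 : R) 1 d (A' 0 0 + A' 1 1).
  have /is_derive_mxP iAij := iA.
  have H := is_deriveB (is_deriveM (iAij 0 0) (iAij 1 1))
                       (is_deriveM (iAij 0 1) (iAij 1 0)).
  apply: (is_derive_eq H); rewrite A0 !mxE /=.
  by rewrite !scale0r addr0 subr0 !mulr1n !scale1r addrC.
have idV : is_derive (0 : R) 1 (fun t => (d t)^-1) (- (A' 0 0 + A' 1 1)).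
  have dn0 : d 0 != 0 by rewrite d0 oner_neq0.
  have [dd d'] := id'.
  split; first exact: derivableV.
  by rewrite deriveV// d0 d' expr1n invr1 scaleN1r.
(* The correction 1/d sits in the third diagonal place, so that n e = e n = e. Where d vanishes the
   inverse is 0 by convention, so the lift has determinant 1 only near 0. *)
pose n t : 'M[R]_4 := diag_mx (\row_j if j == 2%N :> nat then (d t)^-1 else 1).
pose n' : 'M[R]_4 := diag_mx (\row_j if j == 2%N :> nat then - (A' 0 0 + A' 1 1) else 0).
have iN : is_derive (0 : R) 1 n n'.
  apply/is_derive_mxP => i j; rewrite !mxE.
  have -> : (fun t => n t i j) = fun t =>
      (if i == 2%N :> nat then (d t)^-1 else 1) *+ (i == j).
    by apply/funext => t; rewrite !mxE.
  case: (i == j); last by rewrite !mulr0n; exact: is_derive_cst.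
  rewrite !mulr1n; under eq_fun do rewrite mulr1n.
  by case: (_ == 2%N); [exact: idV|exact: is_derive_cst].
have n0 : n 0 = 1%:M.
  apply/matrixP => i j; rewrite !mxE d0 invr1.
  by case: ifP => _.
pose c0 t := A t + (1%:M - A t *m B t) *m (1%:M - E).
have c00 : c0 0 = 1%:M.
  rewrite /c0 A0 B0 E4_idem mulmxBr mulmx1 mulmxBl mul1mx E4_idem subrr subr0.
  by rewrite addrC subrK.
have ic0 : is_derive (0 : R) 1 c0 (A' - E *m B' *m (1%:M - E)).
  have H1 := is_deriveB (is_derive_cst (1%:M : 'M[R]_4) (0 : R) 1) (is_derive_mulmx iA iB).
  have H := is_deriveD iA (is_derive_mulmx H1 iE1).
  apply: (is_derive_eq H); rewrite mulmx0 addr0 A0 B0 sub0r.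
  rewrite mulNmx mulmxDl A'E; congr (_ - _).
  by rewrite mulmxBr mulmx1 A'E subrr add0r.
pose c t := c0 t *m n t.
have ic := is_derive_mulmx ic0 iN.
rewrite n0 c00 mulmx1 mul1mx in ic.
have detc t : d t != 0 -> \det (c t) = 1.
  move=> dt; have -> : \det (c t) = d t * \det (n t) by rewrite /c det_mulmx det_section.
  by rewrite det_diag !big_ord_recl big_ord0 !mxE /= !mul1r !mulr1 mulfV.
(* This is the derivative of [c] at 0. The middle term is traceless because (1 - e) e = 0; since A'
   e = A', the trace of A' is [A' 0 0 + A' 1 1], which n' cancels. *)
exists (A' - E *m B' *m (1%:M - E) + n').
  rewrite linearD linearB/= -mulmxA mxtrace_mulC -mulmxA.
  rewrite [(1%:M - E) *m E]mulmxBl mul1mx E4_idem subrr mulmx0 mxtrace0 subr0.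
  rewrite -A'E /mxtrace !big_ord_recl !big_ord0 !mulmxE4 !mxE /=.
  have -> : lift ord0 ord0 = 1 :> 'I_4 by exact: val_inj.
  ring.
apply: (velocity_lift (c := c)) ic; first by rewrite /c c00 n0 mulmx1.
have dn : \forall t \near 0, d t != 0.
  have cd : {for 0, continuous d}.
    by apply: differentiable_continuous; apply/derivable1_diffP; have [] := id'.
  have nz : nbhs (d 0) [set x : R | x != 0].
    rewrite d0; apply: open_nbhs_nbhs; split; first exact: open_neq.
    exact: oner_neq0.
  exact: cd nz.
near=> t.
have dt : d t != 0 by near: t.
pose s := rep (gamma t); exists (MkSL4 (detc t dt)) => //.
rewrite -(repK (gamma t)) -/s.
(* With s a representative, e s^-1 c = B c0 n = e n = e and s^-1 c e = s^-1 A = e, so c and s lie in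
   the same coset. *)
have Ll : SL2block R (SL4mul (SL4inv s) (MkSL4 (detc t dt))).
  have nE : n t *m E = E.
    apply/matrixP => i j; rewrite mulmxE4 !mxE.
    case: (i =P j) => [->|_]; last by rewrite !mulr0n mul0r.
    by case: j => [[|[|[|j]]] ?] /=; rewrite ?mulr1 ?mulr0.
  have En : E *m n t = E.
    apply/matrixP => i j; rewrite mulE4mx !mxE.
    by case: i => [[|[|[|i]]] ?] /=; rewrite ?mul1r ?mul0r ?mul0rn.
  have E1E : (1%:M - E) *m E = 0 by rewrite mulmxBl mul1mx E4_idem subrr.
  apply: SL2blockP; rewrite /= /c.
    rewrite mulmxA -[E *m \adj s]/(B t) mulmxA.
    have -> : B t *m c0 t = E.
      rewrite /c0 mulmxDr BA mulmxA (mulmxBr (B t)) mulmx1 (mulmxA (B t)) BA EB.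
      by rewrite subrr mul0mx addr0.
    exact: En.
  rewrite -!mulmxA nE /c0 mulmxDl -(mulmxA _ (1%:M - E)) E1E mulmx0 addr0 AE.
  by rewrite /A mulmxA SL4_mulVmx mul1mx.
rewrite -(projM s Ll); congr proj.
by apply: SL4_inj; rewrite /= mulmxA SL4_mulmxV mul1mx.
Unshelve. all: by end_near. Qed.

(** Translation by [g^-1] brings a curve to the origin, where [velocity_origin] applies; the result
    is pushed back by [g], and [dpr_alpha] discards the part in l. *)
Lemma tangentP g D : tangent (proj g) D <-> exists a, D = iotag g a.
Proof.
split=> [[gamma [sg g0 ->]]|[a ->]]; last by apply: tangent_dpr; exact: trace_alpha_inv.
have h0 : (act (SL4inv g) \o gamma) 0 = proj (SL4one R).
  by rewrite /= g0 act_proj; congr proj; apply: SL4_inj; rewrite /= SL4_mulVmx.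
have [Y trY vY] := velocity_origin (smooth_curve_act (SL4inv g) sg) h0.
exists (alpha Y); rewrite -dpr_alpha//.
have -> : velocity gamma = push g (velocity (act (SL4inv g) \o gamma)).
  rewrite push_velocity; congr velocity; apply/funext => t /=.
  rewrite -(repK (gamma t)) !act_proj; congr proj; apply: SL4_inj.
  by rewrite /= mulmxA SL4_mulmxV mul1mx.
have eY : SL4val (SL4one R) *m Y = Y by rewrite mul1mx.
rewrite vY -{1}eY push_dpr//.
by have -> : SL4mul g (SL4one R) = g by apply: SL4_inj; rewrite /= mulmx1.
Qed.

End TangentRange.

(** * The invariant structure *)

Section InvariantStructure.
Variable R : realType.
Implicit Types (g h k : SL4 R) (X Y : 'M[R]_4) (f : Cinf R) (a b : EH R) (D : tvec R).

Lemma iotag_coset l : SL2block R l -> exists t u v w : R,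
  t ^+ 2 - u ^+ 2 + v ^+ 2 - w ^+ 2 = 1 /\
  forall g a, iotag (SL4mul g l) a = iotag g (twist t u v w a).
Proof.
move=> Ll; have [p [q [r [s [det1 lE lVE]]]]] := SL2blockE Ll.
exists (2^-1 * (p + s)), (2^-1 * (p - s) + q), (2^-1 * (p - r - s) + q),
  (2^-1 * (p - r - s)); split=> [|g a]; first by apply: etrans det1; field.
rewrite /iotag (dpr_coset g Ll (trace_alpha_inv a)) lVE lE.
by rewrite -(alpha_inv_conj _ det1) (conj_alphaE _ det1).
Qed.

Lemma iotagP g (t : R) a b :
  iotag g (t *: a + b) = fun f => t * iotag g a f + iotag g b f.
Proof.
apply/funext => f; rewrite /iotag alpha_invP mulmxDr -scalemxAr; exact: dprP.
Qed.

Lemma iotag0 g : iotag g 0 = fun=> 0.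
Proof.
by have := iotagP g (-1) 0 0; rewrite scaler0 addr0 => ->; apply/funext => f;
  rewrite mulN1r addNr.
Qed.

Lemma iotagN g a : iotag g (- a) = fun f => - iotag g a f.
Proof.
have := iotagP g (-1) a 0; rewrite addr0 scaleN1r => ->; apply/funext => f.
by rewrite iotag0 addr0 mulN1r.
Qed.

Lemma iotag_sum g a f : iotag g a f = \sum_j a 0 j * iotag g (delta_mx 0 j) f.
Proof.
have -> : iotag g a f = (fun a => iotag g a f : R) (\sum_j a 0 j *: delta_mx 0 j).
  by rewrite -row_sum_delta.
elim/big_ind2 : _ => [|x y c d <- <-|j _] /=.
- by rewrite iotag0.
- by rewrite -[y]scale1r iotagP mul1r scale1r.
- by rewrite -[_ *: _]addr0 iotagP iotag0 addr0.
Qed.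

Lemma push_iotag h g a : push h (iotag g a) = iotag (SL4mul h g) a.
Proof. by rewrite /iotag push_dpr ?trace_alpha_inv. Qed.

Lemma tangent_iotag g a : tangent (proj g) (iotag g a).
Proof. by apply/tangentP; exists a. Qed.

Lemma coordgP g (t : R) D D' :
  coordg g (fun f => t * D f + D' f) = t *: coordg g D + coordg g D'.
Proof.
rewrite /coordg -linearP; congr alpha.
have -> : Umat (fun f => t * D f + D' f) = t *: Umat D + Umat D'.
  by apply/matrixP => i j; rewrite !mxE.
have -> : Vmat (fun f => t * D f + D' f) = t *: Vmat D + Vmat D'.
  by apply/matrixP => i j; rewrite !mxE.
rewrite (mulmxDr (\adj g)) -scalemxAr !(mulmxDl (t *: _), mulmxDl (_ *m g)).
rewrite -!scalemxAl scalerBr.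
by rewrite opprD addrACA.
Qed.

(** By [dpr_ext] the extension chosen at [g] computes the frame at all nearby points. The direction
    depends linearly on the point, and expanding it in matrix units leaves fixed directional
    derivatives of that extension. *)
Lemma smooth_iotag a f : smooth_SL4 (fun g => iotag g a f).
Proof.
move=> g; have [U Ug [oU CF FE]] := extP f g.
set F := ext f g in CF FE.
exists U, (fun x => \sum_i \sum_j (x *m alpha_inv a) i j * 'D_(delta_mx i j) F x).
split=> // [k|x Ux].
  apply: Ck_on_sum => // i _; apply: Ck_on_sum => // j _; apply: Ck_onM => //.
    have -> : (fun x : 'M[R]_4 => (x *m alpha_inv a) i j) =
        fun x => \sum_l x i l * alpha_inv a l j.
      by apply/funext => x; rewrite mxE.
    apply: Ck_on_sum => // l _; apply: Ck_onM => //; first exact: Ck_on_coord.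
    exact: Ck_on_cst.
  by have [_] := CF k.+1; apply.
rewrite -differentiable_sum_delta; last exact: smooth_on_diff CF Ux.
by rewrite /iotag (@dpr_ext _ f U F)// trace_alpha_inv.
Qed.

(** The coordinates are polynomial in [g] and in the values of X on the finitely many functions
    [ufun] and [vfun]. *)
Lemma smooth_coordg (X : homsp R -> tvec R) : smooth_vector_field X ->
  smooth_mx (fun g => coordg g (X (proj g))).
Proof.
move=> [_ sX]; apply: (@smooth_mx_linear R _ _ _ _ (@alpha R)).
have sU : smooth_mx (fun g => Umat (X (proj g))).
  move=> i j; have -> : (fun g => Umat (X (proj g)) i j) =
    fun g => X (proj g) (ufun R i j) by apply/funext => g; rewrite mxE.
  exact: sX.
have sV : smooth_mx (fun g => Vmat (X (proj g))).
  move=> i j; have -> : (fun g => Vmat (X (proj g)) i j) =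
    fun g => X (proj g) (vfun R i j) by apply/funext => g; rewrite mxE.
  exact: sX.
apply: smooth_mxB; first exact: smooth_mx_mul (@smooth_mx_adj R) sU.
apply: smooth_mx_mul (smooth_mx_cst _).
exact: smooth_mx_mul sV (@smooth_mx_val R).
Qed.

Lemma iotag_one a : iotag (SL4one R) a = dpr (SL4one R) (alpha_inv a).
Proof. by rewrite /iotag mul1mx. Qed.

Section InvariantEndo.
Variable S : {linear EH R -> EH R}.
Hypothesis S_twist : forall t u v w a, S (twist t u v w a) = twist t u v w (S a).

Definition inv_endo : endo_field R :=
  fun p D => iotag (rep p) (S (coordg (rep p) D)).

(** Independence of the representative: the frames at [g] and at the chosen one differ by a twist,
    with which [S] commutes. *)
Lemma inv_endoE g a : inv_endo (proj g) (iotag g a) = iotag g (S a).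
Proof.
have [l Ll gl] : exists2 l, SL2block R l & g = SL4mul (rep (proj g)) l.
  by apply: proj_eq; rewrite repK.
have [t [u [v [w [_ Hl]]]]] := iotag_coset Ll.
(* The representative itself mentions [g], so it is generalized before [g] is replaced. *)
rewrite /inv_endo; move: (rep (proj g)) gl => k ->.
by rewrite (Hl k a) (Hl k (S a)) coordg_iotag S_twist.
Qed.

Lemma smooth_inv_endo : smooth_endo inv_endo.
Proof.
split=> [p D tD|p t D D' _ _|X sX].
- by rewrite -{1}(repK p); exact: tangent_iotag.
- by rewrite /inv_endo coordgP linearP iotagP.
have [tX _] := sX; split=> [p|f].
  by rewrite -{1}(repK p); exact: tangent_iotag.
(* Pulled back to the group, the image field is a combination of frame fields with smooth
   coefficients. *)
rewrite /smooth_fun (_ : _ \o _ = fun g => \sum_j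
  S (coordg g (X (proj g))) 0 j * iotag g (delta_mx 0 j) f).
  apply: smooth_SL4_sum => j; apply: smooth_SL4M; last exact: smooth_iotag.
  exact: (smooth_mx_linear S (smooth_coordg sX)).
apply/funext => g /=; have /tangentP[a ->] := tX (proj g).
by rewrite inv_endoE coordg_iotag iotag_sum.
Qed.

Lemma invariant_inv_endo : invariant_endo inv_endo.
Proof.
move=> g p D; rewrite -(repK p) => /tangentP[a ->].
by rewrite act_proj push_iotag !inv_endoE push_iotag.
Qed.

Lemma almost_complex_inv_endo : (forall a, S (S a) = - a) -> almost_complex inv_endo.
Proof.
move=> SS; split; first exact: smooth_inv_endo.
by move=> p D; rewrite -(repK p) => /tangentP[a ->]; rewrite !inv_endoE SS iotagN.
Qed.

End InvariantEndo.

(** * The invariant 2-form and its compatibility with the complex structures *)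

Definition inv_form : form_field R :=
  fun p D D' => omega_std (coordg (rep p) D) (coordg (rep p) D').

Lemma omega_stdP (t : R) a b c :
  omega_std (t *: a + b) c = t * omega_std a c + omega_std b c.
Proof.
rewrite /omega_std mulr_sumr -big_split; apply: eq_bigr => r _ /=.
by rewrite !mxE; ring.
Qed.

Lemma omega_stdC a b : omega_std a b = - omega_std b a.
Proof. by rewrite /omega_std -sumrN; apply: eq_bigr => r _; ring. Qed.

(** Pairing with [EHf R i] and [EHe R i] reads off the coordinates up to sign. *)
Lemma omega_std_nondegenerate a : (forall b, omega_std a b = 0) -> a = 0.
Proof.
move=> a0; apply/rowP => i; rewrite [RHS]mxE.
case: (split_ordP i) => {}i ->.
  have := a0 (EHf R i); rewrite /omega_std (bigD1 i)//= big1 => [|r ri].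
    by rewrite !mxE !eqxx eq_shift mulr1 mulr0 subr0 addr0.
  by rewrite !mxE !eq_shift (negbTE ri) !mulr0 subr0.
have := a0 (EHe R i); rewrite /omega_std (bigD1 i)//= big1 => [|r ri].
  rewrite !mxE !eqxx eq_shift mulr1 mulr0 sub0r addr0 => /eqP.
  by rewrite oppr_eq0 => /eqP.
by rewrite !mxE !eq_shift (negbTE ri) !mulr0 subr0.
Qed.

Lemma omega_twist (t u v w : R) a b : t ^+ 2 - u ^+ 2 + v ^+ 2 - w ^+ 2 = 1 ->
  omega_std (twist t u v w a) (twist t u v w b) = omega_std a b.
Proof.
by move=> E; apply/eqP; rewrite -subr_eq0 omega_std_twist E subrr mul0r.
Qed.

(** Here too the change of frame is a twist, now preserving the form because its norm is 1. *)
Lemma inv_formE g a b : inv_form (proj g) (iotag g a) (iotag g b) = omega_std a b.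
Proof.
have [l Ll gl] : exists2 l, SL2block R l & g = SL4mul (rep (proj g)) l.
  by apply: proj_eq; rewrite repK.
have [t [u [v [w [E Hl]]]]] := iotag_coset Ll.
rewrite /inv_form; move: (rep (proj g)) gl => k ->.
by rewrite (Hl k a) (Hl k b) !coordg_iotag; exact: omega_twist.
Qed.

Lemma two_form_inv_form : two_form inv_form.
Proof.
split=> [p t D D' D'' _ _ _|p D D' _ _|X Y sX sY].
- by rewrite /inv_form coordgP omega_stdP.
- exact: omega_stdC.
rewrite /smooth_fun (_ : _ \o _ = fun g =>
    omega_std (coordg g (X (proj g))) (coordg g (Y (proj g)))).
  have sx := smooth_coordg sX; have sy := smooth_coordg sY.
  apply: smooth_SL4_sum => r.
  have e (a : EH R) : lsubmx a 0 r = a 0 (lshift _ r) by rewrite mxE.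
  have e' (a : EH R) : rsubmx a 0 r = a 0 (rshift _ r) by rewrite mxE.
  under eq_fun do rewrite !e !e'.
  apply: smooth_SL4D; first exact: smooth_SL4M.
  by apply: smooth_SL4N; exact: smooth_SL4M.
apply/funext => g /=; have [[tX _] [tY _]] := (sX, sY).
have /tangentP[a ->] := tX (proj g); have /tangentP[b ->] := tY (proj g).
by rewrite !coordg_iotag; exact: inv_formE.
Qed.

Lemma nondegenerate_inv_form : Defs.nondegenerate inv_form.
Proof.
move=> p D; rewrite -(repK p) => /tangentP[a ->] H.
rewrite (_ : a = 0) ?iotag0//; apply: omega_std_nondegenerate => b.
by rewrite -(inv_formE (rep p)); apply: H; exact: tangent_iotag.
Qed.

Lemma invariant_inv_form : invariant_form inv_form.
Proof.
move=> g p D D'; rewrite -(repK p) => /tangentP[a ->] /tangentP[b ->].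
by rewrite act_proj !push_iotag !inv_formE.
Qed.

Lemma Hermitian_inv (S : {linear EH R -> EH R}) :
  (forall t u v w a, S (twist t u v w a) = twist t u v w (S a)) ->
  (forall a b, omega_std (S a) (S b) = omega_std a b) ->
  Hermitian_for (inv_endo S) inv_form.
Proof.
move=> St Sw p D D'; rewrite -(repK p) => /tangentP[a ->] /tangentP[b ->].
by rewrite !(inv_endoE St) !inv_formE Sw.
Qed.

Lemma J1stdP (t : R) a b : J1std (t *: a + b) = t *: J1std a + J1std b.
Proof.
by apply: EH_eq => k; split; rewrite ?(row_mxEl, row_mxEr, mxE) //; ring.
Qed.

Lemma J2stdP (t : R) a b : J2std (t *: a + b) = t *: J2std a + J2std b.
Proof.
by apply: EH_eq => k; split; rewrite ?(row_mxEl, row_mxEr, mxE) //; ring.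
Qed.

Lemma J3stdP (t : R) a b : J3std (t *: a + b) = t *: J3std a + J3std b.
Proof.
by apply: EH_eq => k; split; rewrite ?(row_mxEl, row_mxEr, mxE) //; ring.
Qed.

HB.instance Definition _ := GRing.isLinear.Build R (EH R) (EH R) _ (@J1std R) J1stdP.
HB.instance Definition _ := GRing.isLinear.Build R (EH R) (EH R) _ (@J2std R) J2stdP.
HB.instance Definition _ := GRing.isLinear.Build R (EH R) (EH R) _ (@J3std R) J3stdP.

Lemma omega_J1std a b : omega_std (J1std a) (J1std b) = omega_std a b.
Proof.
rewrite !omega_stdE !J1stdE !big_ord_recr !big_ord0 /= !coord_row12//=; ring.
Qed.

Lemma omega_J2std a b : omega_std (J2std a) (J2std b) = omega_std a b.
Proof.
rewrite !omega_stdE !J2stdE !big_ord_recr !big_ord0 /= !coord_row12//=; ring.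
Qed.

Lemma omega_J3std a b : omega_std (J3std a) (J3std b) = omega_std a b.
Proof.
rewrite !omega_stdE !J3stdE !big_ord_recr !big_ord0 /= !coord_row12//=; ring.
Qed.

End InvariantStructure.

Theorem proposition4p6 (R : realType) :
  exists (J1 J2 J3 : endo_field R) (w : form_field R) (iota : EH R -> tvec R),
    [/\ SOstar6_structure J1 J2 J3 w,
        [/\ invariant_endo J1, invariant_endo J2, invariant_endo J3
          & invariant_form w],
        (forall a D, dproj (SL4one R) (alpha_inv a) D <-> D = iota a),
        [/\ (forall (t : R) a b f, iota (t *: a + b) f = t * iota a f + iota b f),
            injective iota
          & range iota = tangent (origin R)]
      & [/\ (forall a, J1 (origin R) (iota a) = iota (J1std a)),
            (forall a, J2 (origin R) (iota a) = iota (J2std a)),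
            (forall a, J3 (origin R) (iota a) = iota (J3std a))
          & (forall a b, w (origin R) (iota a) (iota b) = omega_std a b)]].
Proof.
have tw1 := @J1std_twist R; have tw2 := @J2std_twist R; have tw3 := @J3std_twist R.
(* The standard tensors are spread by the frames; [iota] is the frame at the identity. *)
exists (inv_endo (@J1std R)), (inv_endo (@J2std R)), (inv_endo (@J3std R)),
  (@inv_form R), (iotag (SL4one R)).
have E1 := @inv_endoE R (@J1std R) tw1.
have E2 := @inv_endoE R (@J2std R) tw2.
have E3 := @inv_endoE R (@J3std R) tw3.
split.
- split.
  + split; try (apply: almost_complex_inv_endo => // a;
      by have [] := J_std_quaternionic a).
    move=> p D; rewrite -(repK p) => /tangentP[a ->].
    have [_ _ _ e12 e21] := J_std_quaternionic a.
    rewrite E3 E2 !E1 E2 -iotagN.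
    by split; congr iotag; [exact: e12|exact: e21].
  + exact: two_form_inv_form.
  + exact: nondegenerate_inv_form.
  + split; apply: Hermitian_inv => //.
    * exact: omega_J1std.
    * exact: omega_J2std.
    * exact: omega_J3std.
- split; try exact: invariant_inv_endo.
  exact: invariant_inv_form.
- move=> a D; rewrite iotag_one; split=> [[c [_ c0 dc ->]]|->].
    by apply: (velocity_lift _ (is_lift_proj _) dc); rewrite c0.
  (* Conversely, the [LDU] curve with initial velocity [alpha_inv a] realizes the vector. *)
  have trX := trace_alpha_inv a.
  exists (transl (SL4one R) trX); split.
  + exact: smooth_transl.
  + exact: transl0.
  + by have := is_derive_transl (SL4one R) trX; rewrite mul1mx.
  + by rewrite velocity_transl mul1mx.
- split=> [t a b f|a b /(congr1 (coordg (SL4one R)))|].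
  + by rewrite iotagP.
  + by rewrite !coordg_iotag.
  + apply/seteqP; split=> [_ [a _ <-]|D]; first exact: tangent_iotag.
    by move=> /(tangentP (SL4one R))[a ->]; exists a.
- split=> [a|a|a|a b]; [exact: E1|exact: E2|exact: E3|].
  exact: inv_formE.
Qed.
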